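(* Let $\mathbb{F}$ be a skew field. (a) Let $\Phi$ be a gain graph with node set $N$, no half edges, gains in $\mathbb{F}^+$, and no two links with the same endpoints and equal gain; let $\Delta$ be the simple graph on $N$ obtained by merging parallel edges. In $\mathbb{F}^{1+N}=\mathbb{F}\times\mathbb{F}^N$ (with unit vectors $\hat v$, $v\in N$), set $\mathbf{z}_\Phi(e_{vw})=(\varphi(e_{vw}),\hat w-\hat v)$ and $\mathbf{z}_\Phi(e_0)=(1,\mathbf0)$. In the projective space $\mathbb{P}$ of $\mathbb{F}^{1+N}$, let $\mathbb{P}'$ be the image of $\{0\}\times\mathbb{F}^N$, $\mathbf{z}'(vw)=[0,\hat w-\hat v]$ for $vw\in E(\Delta)$, $\hat e_0=[1,\mathbf0]$, and $\hat E=\{[\mathbf{z}_\Phi(e)]:e\in E(\Phi)\}$. Then $\mathbf{z}'$ is a projective representation of $G(\Delta)$ in $\mathbb{P}'$, $\hat E\subseteq\hat E(\Delta,\hat e_0)\setminus\{\hat e_0\}$, and $e\mapsto[\mathbf{z}_\Phi(e)]$ is an isomorphism $\langle\Phi\rangle\cong\Omega_0(\hat E)$; i.e., the projectivization of $\mathbf{z}_\Phi$ is a synthetic orthographic representation of $\langle\Phi\rangle$. (b) Conversely, if $\mathbb{P}$ is a projective space over $\mathbb{F}$ and $\hat E$ is a synthetic orthographic representation (with data $\mathbb{P}',\Delta,\mathbf{z}',\hat e_0$) of a biased graph $\Omega$, then there is a gain graph $\Phi$ on $\|\Omega\|$ with gains in $\mathbb{F}^+$ and $\langle\Phi\rangle=\Omega$,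 and, after possibly enlarging $\mathbb{P}$ and choosing coordinates, the points $\hat e_0$ and $\hat e$ ($e\in E(\Omega)$) are the projective points $[1,\mathbf0]$ and $[\mathbf{z}_\Phi(e)]$.
   Context: A projective representation of the graphic matroid $G(\Delta)$: injective map with edge sets independent in $G(\Delta)$ iff images projectively independent. Given a projective geometry $\mathbb{P}$, hyperplane $\mathbb{P}'$, nonempty simple graph $\Delta$, representation $\mathbf{z}':E(\Delta)\to\mathbb{P}'$ and $\hat e_0\in\mathbb{P}\setminus\mathbb{P}'$: edge lines are $\mathbf{z}'(f)\hat e_0$, with union $\hat E(\Delta,\hat e_0)$; for $\hat E\subseteq\hat E(\Delta,\hat e_0)\setminus\{\hat e_0\}$, $\Omega_0(\hat E)$ has node set $N(\Delta)$, one link per point of $\hat E$ with the endpoints of the $f$ whose edge line contains it, and a circle $C$ is balanced iff $\hat e_0\notin\mathrm{Span}\,\hat C$. $\hat E$ is a synthetic orthographic representation of $\Omega$ if $\Omega\cong\Omega_0(\hat E)$. Gains in $\mathbb{F}^+$ satisfy $\varphi(e_{wv})=-\varphi(e_{vw})$; $\langle\Phi\rangle$ has balanced circles those with gain sum $0$. $[\mathbf{x}]$ denotes the projective point spanned by a nonzero vector $\mathbf{x}$. *)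

(* Defs.v *)
From HB Require Import structures.
From mathcomp Require Import all_boot all_order all_algebra.
From mathcomp Require Import all_classical.

Set Implicit Arguments.
Unset Strict Implicit.
Unset Printing Implicit Defensive.

Import GRing.Theory.
Local Open Scope classical_set_scope.
Local Open Scope ring_scope.

(** * Graphs, circles, biased graphs *)

(* Possibly infinite multigraphs all of whose edges are links, i.e. have two
   distinct ends: there are no loops, half edges or loose edges. *)
Record graph := Graph {
  node : Type;
  edge : Type;
  ends : edge -> set node;
  ends_link : forall e, exists v w, v <> w /\ ends e = [set v; w]
}.

Definition joins (G : graph) (e : edge G) (v w : node G) : Prop :=
  v <> w /\ ends e = [set v; w].

Definition simple (G : graph) : Prop := injective (@ends G).

(* v_0 e_0 v_1 e_1 ... v_{k-1} e_{k-1} v_0; ordS is the cyclic successor. *)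
Definition circle_walk (G : graph) (k : nat)
    (v : 'I_k -> node G) (e : 'I_k -> edge G) : Prop :=
  [/\ (1 < k)%N, injective v, injective e
    & forall i, joins (e i) (v i) (v (ordS i))].

(* Circles are identified with their edge sets. *)
Definition circle (G : graph) (C : set (edge G)) : Prop :=
  exists k (v : 'I_k -> node G) (e : 'I_k -> edge G),
    circle_walk v e /\ C = range e.

Definition graphic_indep (G : graph) (S : set (edge G)) : Prop :=
  ~ exists2 C, circle C & C `<=` S.

(* The path v_0 e_0 v_1 ... e_{k-1} v_k from u to w, with edge set A and
   node set X. *)
Definition path_from (G : graph) (u w : node G)
    (A : set (edge G)) (X : set (node G)) : Prop :=
  exists k (v : 'I_k.+1 -> node G) (e : 'I_k -> edge G),
    [/\ injective v,
        forall i, joins (e i) (v (widen_ord (leqnSn k) i)) (v (lift ord0 i)),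
        v ord0 = u /\ v ord_max = w
      & A = range e /\ X = range v].

(* A theta graph, presented by the edge sets of its three constituent paths;
   its circles are the unions of two of them. *)
Definition theta (G : graph) (A1 A2 A3 : set (edge G)) : Prop :=
  exists u w X1 X2 X3,
    [/\ u <> w,
        [/\ path_from u w A1 X1, path_from u w A2 X2 & path_from u w A3 X3],
        [/\ A1 `&` A2 = set0, A1 `&` A3 = set0 & A2 `&` A3 = set0]
      & [/\ X1 `&` X2 = [set u; w], X1 `&` X3 = [set u; w]
          & X2 `&` X3 = [set u; w]]].

(* A graph with a class of distinguished edge sets; it is a biased graph when
   it satisfies [is_biased]. *)
Record bgraph := BGraph {
  underlying : graph;
  balanced : set (set (edge underlying))
}.
Arguments balanced : clear implicits.

(* Since theta is symmetric in its three paths, the last clause says that no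
   theta subgraph contains exactly two balanced circles. *)
Definition is_biased (O : bgraph) : Prop :=
  (forall C, balanced O C -> circle C) /\
  (forall A1 A2 A3 : set (edge (underlying O)), theta A1 A2 A3 ->
     balanced O (A1 `|` A2) -> balanced O (A2 `|` A3) ->
     balanced O (A1 `|` A3)).

Definition bgraph_iso (O1 O2 : bgraph)
    (a : node (underlying O1) -> node (underlying O2))
    (b : edge (underlying O1) -> edge (underlying O2)) : Prop :=
  [/\ bijective a, bijective b,
      forall e, ends (b e) = a @` ends e
    & forall C, balanced O1 C <-> balanced O2 (b @` C)].

(* One edge for each set of ends occurring in G. *)
Lemma merge_link (G : graph) (f : set_type (range (@ends G))) :
  exists v w, v <> w /\ val f = [set v; w].
Proof. by case: f => f /= /set_mem [e _ <-]; exact: ends_link. Qed.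

Definition merge_parallel (G : graph) : graph := Graph (@merge_link G).

(** * Gain graphs *)

(* [gain e v w] is the gain of e read from v to w; it is meaningful only when
   e joins v and w. *)
Record gains (F : zmodType) (G : graph) := Gains {
  gain : edge G -> node G -> node G -> F;
  gain_opp : forall e v w, joins e v w -> gain e w v = - gain e v w
}.

(* Whether the gain sum vanishes does not depend on the starting node or the
   direction of the walk around C. *)
Definition gain_bgraph (F : zmodType) (G : graph) (Phi : gains F G) : bgraph :=
  @BGraph G [set C | exists k (v : 'I_k -> node G) (e : 'I_k -> edge G),
    [/\ circle_walk v e, C = range e
      & \sum_(i < k) gain Phi (e i) (v i) (v (ordS i)) = 0]].

Definition no_parallel_equal_gain (F : zmodType) (G : graph)
    (Phi : gains F G) : Prop :=
  forall e e' v w, joins e v w -> joins e' v w ->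
    gain Phi e v w = gain Phi e' v w -> e = e'.

(** * Projective geometries *)

Record projGeom := ProjGeom {
  pgpt :> Type;
  lines : set (set pgpt);
  line_ex : forall p q, p <> q -> exists2 L, lines L & L p /\ L q;
  line_uniq : forall p q L M, p <> q -> lines L -> lines M ->
    L p -> L q -> M p -> M q -> L = M;
  line_three : forall L, lines L -> exists p q r,
    [/\ p <> q, p <> r, q <> r & [/\ L p, L q & L r]];
  (* Veblen-Young: if pab and pcd are distinct lines, then ac and bd meet. *)
  veblen : forall p a b c d L M N1 N2,
    lines L -> lines M -> lines N1 -> lines N2 -> L <> M ->
    [/\ L p, L a & L b] -> [/\ M p, M c & M d] ->
    [/\ p <> a, p <> b, p <> c & p <> d] ->
    N1 a /\ N1 c -> N2 b /\ N2 d ->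
    exists x, N1 x /\ N2 x
}.

Definition flat (P : projGeom) (S : set P) : Prop :=
  forall L p q, lines L -> p <> q -> L p -> L q -> S p -> S q -> L `<=` S.

Definition Span (P : projGeom) (A : set P) : set P :=
  [set p | forall S, flat S -> A `<=` S -> S p].

Definition proj_indep (P : projGeom) (A : set P) : Prop :=
  forall p, A p -> ~ Span (A `\ p) p.

Definition hyperplane (P : projGeom) (H : set P) : Prop :=
  [/\ flat H, H <> setT
    & forall S, flat S -> H `<=` S -> S = H \/ S = setT].

Definition line_through (P : projGeom) (p q : P) : set P :=
  [set r | exists2 L, lines L & [/\ L p, L q & L r]].

(** * Synthetic orthographic representations *)

Definition graphic_repr (P : projGeom) (D : graph) (z : edge D -> P) : Prop :=
  injective z /\
  forall S : set (edge D), graphic_indep S <-> proj_indep (z @` S).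

Definition edge_line (P : projGeom) (D : graph) (z : edge D -> P) (e0 : P)
  (f : edge D) : set P := line_through (z f) e0.

Definition edge_points (P : projGeom) (D : graph) (z : edge D -> P) (e0 : P) :
  set P := [set p | exists f, edge_line z e0 f p].

Section Omega0.
Variables (P : projGeom) (D : graph) (z : edge D -> P) (e0 : P) (Eh : set P).
Hypothesis Eh_sub : Eh `<=` edge_points z e0 `\ e0.

(* The edge f of D whose edge line contains p. It is unique as soon as z is
   injective with values in a flat that does not contain e0. *)
Definition edge_under (p : set_type Eh) : edge D :=
  projT1 (cid (proj1 (Eh_sub (set_mem (valP p))))).

Definition Omega0_graph : graph :=
  @Graph (node D) (set_type Eh) (fun p => ends (edge_under p))
    (fun p => ends_link (edge_under p)).

Definition Omega0 : bgraph :=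
  @BGraph Omega0_graph
    [set C : set (edge Omega0_graph) |
       circle C /\ ~ Span [set val (p : set_type Eh) | p in C] e0].

End Omega0.

(* The node map [a] and the map [b] from edges to points constitute an
   isomorphism of O with Omega0 of the point set Eh. *)
Definition iso_Omega0 (P : projGeom) (D : graph) (z : edge D -> P) (e0 : P)
    (Eh : set P) (O : bgraph) (a : node (underlying O) -> node D)
    (b : edge (underlying O) -> P) : Prop :=
  exists (hE : Eh `<=` edge_points z e0 `\ e0)
         (b' : edge (underlying O) -> edge (underlying (Omega0 hE))),
    (forall e, \val (b' e : set_type Eh) = b e) /\
    @bgraph_iso O (Omega0 hE) a b'.

Record orthographic_frame (P : projGeom) (H : set P) (D : graph)
    (z : edge D -> P) (e0 : P) : Prop := OrthographicFrame {
  frame_hyperplane : hyperplane H;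
  frame_nonempty : inhabited (node D);
  frame_simple : simple D;
  frame_in : forall f, H (z f);
  frame_repr : graphic_repr z;
  frame_e0 : ~ H e0
}.

Definition synthetic_orthographic (P : projGeom) (H : set P) (D : graph)
    (z : edge D -> P) (e0 : P) (Eh : set P) (O : bgraph)
    (a : node (underlying O) -> node D)
    (b : edge (underlying O) -> P) : Prop :=
  orthographic_frame H z e0 /\ iso_Omega0 z e0 Eh a b.

(** * Projective spaces over a skew field *)

Section PG.
Variables (F : unitRingType) (hF : GRing.field_axiom F) (V : lmodType F).

Definition span1 (x : V) : set V := [set a *: x | a in setT].

Definition pg_point : Type :=
  set_type [set L : set V | exists2 x, x != 0 & L = span1 x].

Definition Pt (x : V) (hx : x != 0) : pg_point :=
  exist _ (span1 x) (mem_set (ex_intro2 _ _ x hx erefl)).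

Definition pg_join (p q : pg_point) : set pg_point :=
  [set r | val r `<=` [set x + y | x in val p & y in val q]].

Definition pg_lines : set (set pg_point) :=
  [set L | exists p q, p <> q /\ L = pg_join p q].

Lemma pg_pointP (p : pg_point) : exists2 x, x != 0 & val p = span1 x.
Proof. by case: p => L /= /set_mem. Qed.

Lemma span1_id (x : V) : span1 x x.
Proof. by exists 1 => //; rewrite scale1r. Qed.

Lemma scalerVK (a : F) (x y : V) : a != 0 -> a *: x = y -> x = a^-1 *: y.
Proof. by move=> a0 <-; rewrite scalerA mulVr ?scale1r //; exact: hF. Qed.

Lemma Pt_eq (p q : pg_point) (x y : V) (a : F) : val p = span1 x ->
  val q = span1 y -> y != 0 -> y = a *: x -> p = q.
Proof.
move=> px qy y0 yx; apply: val_inj; rewrite px qy; apply/seteqP.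
have a0 : a != 0 by apply: contraNneq y0 => a0; rewrite yx a0 scale0r.
split=> _ [b _ <-].
  exists (b * a^-1) => //.
  by rewrite yx scalerA -mulrA mulVr ?mulr1 //; exact: hF.
by exists (b * a) => //; rewrite -scalerA yx.
Qed.

Lemma pg_joinP (p q r : pg_point) (x y t : V) :
    val p = span1 x -> val q = span1 y -> val r = span1 t ->
  pg_join p q r <-> exists a b, t = a *: x + b *: y.
Proof.
move=> px qy rt; rewrite /pg_join /= px qy rt; split.
  by move=> /(_ t (span1_id t)) [_ [a _ <-] [_ [b _ <-] <-]]; exists a, b.
move=> [a [b ->]] _ [c _ <-]; exists (c *: (a *: x)).
  by exists (c * a) => //; rewrite scalerA.
exists (c *: (b *: y)); first by exists (c * b) => //; rewrite scalerA.
by rewrite scalerDr.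
Qed.

Lemma pg_joinC (p q : pg_point) : pg_join p q = pg_join q p.
Proof.
have [x x0 px] := pg_pointP p; have [y y0 qy] := pg_pointP q.
apply/seteqP; split=> r; have [t t0 rt] := pg_pointP r.
  move/(pg_joinP px qy rt) => [a [b tE]]; apply/(pg_joinP qy px rt).
  by exists b, a; rewrite tE addrC.
move/(pg_joinP qy px rt) => [a [b tE]]; apply/(pg_joinP px qy rt).
by exists b, a; rewrite tE addrC.
Qed.

Lemma pg_join_l (p q : pg_point) : pg_join p q p.
Proof.
have [x x0 px] := pg_pointP p; have [y y0 qy] := pg_pointP q.
by apply/(pg_joinP px qy px); exists 1, 0; rewrite scale1r scale0r addr0.
Qed.

Lemma pg_join_r (p q : pg_point) : pg_join p q q.
Proof. by rewrite pg_joinC; exact: pg_join_l. Qed.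

Lemma pg_join_exch (p q r : pg_point) :
  q <> p -> pg_join p r q -> pg_join p q = pg_join p r.
Proof.
have [x x0 px] := pg_pointP p; have [y y0 qy] := pg_pointP q.
have [t t0 rt] := pg_pointP r.
move=> qp /(pg_joinP px rt qy) [a [b yE]].
have b0 : b != 0.
  apply/eqP => b0; apply: qp; symmetry; apply: (Pt_eq px qy y0) (_ : y = a *: x).
  by rewrite yE b0 scale0r addr0.
have tE : t = b^-1 *: (y - a *: x).
  by apply: scalerVK => //; rewrite yE addrC addKr.
apply/seteqP; split=> s; have [u u0 su] := pg_pointP s.
  move/(pg_joinP px qy su) => [c [d uE]]; apply/(pg_joinP px rt su).
  exists (c + d * a), (d * b).
  by rewrite uE yE scalerDr !scalerA addrA scalerDl.
move/(pg_joinP px rt su) => [c [d uE]]; apply/(pg_joinP px qy su).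
exists (c - d * b^-1 * a), (d * b^-1).
rewrite uE tE scalerA scalerBr scalerBl !scalerA.
by rewrite [X in _ + X]addrC addrA.
Qed.

Lemma pg_line_eq (p q : pg_point) (L : set pg_point) :
  p <> q -> pg_lines L -> L p -> L q -> L = pg_join p q.
Proof.
move=> pq [u [w [uw ->]]] Lp Lq.
have [pu|pu] := pselect (p = u).
  by rewrite pu; symmetry; apply: pg_join_exch => //; rewrite -pu => /esym.
have E : pg_join u p = pg_join u w by apply: pg_join_exch.
rewrite -E pg_joinC; symmetry; apply: pg_join_exch; first by move/esym.
by rewrite pg_joinC E.
Qed.

Lemma pg_line_ex (p q : pg_point) :
  p <> q -> exists2 L, pg_lines L & L p /\ L q.
Proof.
move=> pq; exists (pg_join p q); first by exists p, q.
by split; [exact: pg_join_l|exact: pg_join_r].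
Qed.

Lemma pg_line_uniq (p q : pg_point) (L M : set pg_point) : p <> q ->
  pg_lines L -> pg_lines M -> L p -> L q -> M p -> M q -> L = M.
Proof.
move=> pq hL hM Lp Lq Mp Mq.
by rewrite (pg_line_eq pq hL Lp Lq) (pg_line_eq pq hM Mp Mq).
Qed.

Lemma pg_line_three (L : set pg_point) : pg_lines L -> exists p q r,
  [/\ p <> q, p <> r, q <> r & [/\ L p, L q & L r]].
Proof.
move=> [p [q [pq ->]]].
have [x x0 px] := pg_pointP p; have [y y0 qy] := pg_pointP q.
have xy0 : x + y != 0.
  apply/eqP => /eqP; rewrite addrC addr_eq0 => /eqP yE; apply: pq.
  by apply: (Pt_eq px qy y0) (_ : y = -1 *: x); rewrite scaleN1r.
have rE : val (Pt xy0) = span1 (x + y) by [].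
exists p, q, (Pt xy0); split=> //.
- move=> pr; apply: pq; have := span1_id (x + y).
  rewrite -rE -pr px => -[a _ /eqP]; rewrite addrC -subr_eq => /eqP xE.
  by apply: (Pt_eq px qy y0) (_ : y = (a - 1) *: x); rewrite -xE scalerBl scale1r.
- move=> qr; apply/pq/esym; have := span1_id (x + y).
  rewrite -rE -qr qy => -[a _ /eqP]; rewrite -subr_eq => /eqP xE.
  by apply: (Pt_eq qy px x0) (_ : x = (a - 1) *: y); rewrite -xE scalerBl scale1r.
split; [exact: pg_join_l|exact: pg_join_r|].
by apply/(pg_joinP px qy rE); exists 1, 1; rewrite !scale1r.
Qed.

Lemma pg_veblen (p a b c d : pg_point) (L M N1 N2 : set pg_point) :
  pg_lines L -> pg_lines M -> pg_lines N1 -> pg_lines N2 -> L <> M ->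
  [/\ L p, L a & L b] -> [/\ M p, M c & M d] ->
  [/\ p <> a, p <> b, p <> c & p <> d] ->
  N1 a /\ N1 c -> N2 b /\ N2 d ->
  exists x, N1 x /\ N2 x.
Proof.
move=> hL hM hN1 hN2 LM [Lp La Lb] [Mp Mc Md] [pa pb pc pd] [N1a N1c] [N2b N2d].
have ac : a <> c by move=> ac; subst c; exact/LM/(pg_line_uniq pa).
have bd : b <> d by move=> bd; subst d; exact/LM/(pg_line_uniq pb).
have [x x0 px] := pg_pointP p.
have [xa xa0 aE] := pg_pointP a; have [xb xb0 bE] := pg_pointP b.
have [xc xc0 cE] := pg_pointP c; have [xd xd0 dE] := pg_pointP d.
have := Lb; rewrite (pg_line_eq pa hL Lp La).
move/(pg_joinP px aE bE) => [l [m xbE]].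
have := Md; rewrite (pg_line_eq pc hM Mp Mc).
move/(pg_joinP px cE dE) => [l' [m' xdE]].
have [l0|l0] := eqVneq l 0.
  exists a; split=> //; suff -> : a = b by [].
  by apply: (Pt_eq aE bE xb0) (_ : xb = m *: xa); rewrite xbE l0 scale0r add0r.
have [l'0|l'0] := eqVneq l' 0.
  exists c; split=> //; suff -> : c = d by [].
  by apply: (Pt_eq cE dE xd0) (_ : xd = m' *: xc); rewrite xdE l'0 scale0r add0r.
have m0 : m != 0.
  apply/eqP => m0; apply: pb.
  by apply: (Pt_eq px bE xb0) (_ : xb = l *: x); rewrite xbE m0 scale0r addr0.
pose t := l^-1 *: xb - l'^-1 *: xd.
have tE : t = (l^-1 * m) *: xa - (l'^-1 * m') *: xc.
  rewrite /t xbE xdE !scalerDr !scalerA !mulVr ?hF // !scale1r opprD addrACA.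
  by rewrite subrr add0r.
have lm0 : l^-1 * m != 0.
  apply/eqP => lm; have : l * (l^-1 * m) = 0 by rewrite lm mulr0.
  by rewrite mulrA mulrV ?hF // mul1r; apply/eqP.
have t0 : t != 0.
  apply/eqP => t0; apply/ac/esym; move: tE; rewrite t0 => /esym/eqP.
  rewrite subr_eq0 => /eqP/(scalerVK lm0) E; move: E; rewrite scalerA => E.
  exact: (Pt_eq cE aE xa0 E).
have rE : val (Pt t0) = span1 t by [].
exists (Pt t0); split.
  rewrite (pg_line_eq ac hN1 N1a N1c); apply/(pg_joinP aE cE rE).
  by exists (l^-1 * m), (- (l'^-1 * m')); rewrite scaleNr.
rewrite (pg_line_eq bd hN2 N2b N2d); apply/(pg_joinP bE dE rE).
by exists l^-1, (- l'^-1); rewrite scaleNr.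
Qed.

Definition PG : projGeom :=
  ProjGeom pg_line_ex pg_line_uniq pg_line_three pg_veblen.

End PG.

Section ProjMap.
Variables (F : unitRingType) (V W : lmodType F) (f : {linear V -> W}).
Hypothesis f_inj : injective f.

Lemma proj_map_subproof (p : pg_point V) :
  exists2 y : W, y != 0 & f @` val p = span1 y.
Proof.
have [x x0 ->] := pg_pointP p; exists (f x).
  by apply: contraNneq x0 => fx0; apply/eqP/f_inj; rewrite fx0 linear0.
apply/seteqP; split=> [_ [_ [a _ <-] <-]|_ [a _ <-]].
  by exists a => //; rewrite linearZ.
by exists (a *: x); [exists a|rewrite linearZ].
Qed.

Definition proj_map (p : pg_point V) : pg_point W :=
  exist _ (f @` val p) (mem_set (proj_map_subproof p)).

End ProjMap.

Section Pad.
Variables (F : unitRingType) (V U : lmodType F).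

Definition pad (x : V) : V * U := (x, 0).

Lemma pad_is_linear : linear pad.
Proof. by move=> a x y; rewrite -[RHS]/(_, _) /= scaler0 addr0. Qed.

HB.instance Definition _ :=
  GRing.isLinear.Build F V (V * U)%type _ pad pad_is_linear.

Lemma pad_inj : injective pad.
Proof. by move=> x y []. Qed.

End Pad.

(* The points of PG V inside PG (V x U) *)
Definition pad_point (F : unitRingType) (V U : lmodType F) (p : pg_point V) :
  pg_point (V * U)%type := proj_map (@pad_inj F V U) p.

(** * The orthographic representation of a gain graph *)

Section Coordinates.
Variables (F : unitRingType) (hF : GRing.field_axiom F).

(* F x F^N, as a left vector space over F *)
Definition coord_space (N : Type) : lmodType F := (F^o * (N -> F^o))%type.

Definition hat (N : Type) (v : N) : N -> F^o := fun u => (`[< u = v >])%:R.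

Lemma hat_sub_neq0 (N : Type) (v w : N) : v <> w -> hat w - hat v != 0.
Proof.
move=> vw; apply/eqP => /(congr1 (fun g => g w)) /eqP.
by rewrite subr_eq0 /hat asboolT // asboolF ?oner_eq0 // => /esym.
Qed.

Lemma coord_neq0 (N : Type) (a : F) (v w : N) : v <> w ->
  ((a, hat w - hat v) : coord_space N) != 0.
Proof. by move=> vw; apply: contraNneq (hat_sub_neq0 vw) => -[_ ->]. Qed.

Lemma e0_neq0 (N : Type) : ((1, 0) : coord_space N) != 0.
Proof. by apply/eqP => -[/eqP]; rewrite oner_eq0. Qed.

Definition std_e0 (N : Type) : PG hF (coord_space N) := Pt (e0_neq0 N).

(* The projective image of {0} x F^N *)
Definition std_hyperplane (N : Type) : set (PG hF (coord_space N)) :=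
  [set p | val p `<=` [set x | x.1 = 0]].

Lemma ex_orient (G : graph) (e : edge G) :
  exists vw : node G * node G, joins e vw.1 vw.2.
Proof. by have [v [w vw]] := ends_link e; exists (v, w). Qed.

(* An arbitrary orientation of e, used only to read off the projective points
   below, which do not depend on it: see [z_pointE] and [std_zE]. *)
Definition orient (G : graph) (e : edge G) : node G * node G :=
  projT1 (cid (ex_orient e)).

Lemma orientP (G : graph) (e : edge G) : joins e (orient e).1 (orient e).2.
Proof. exact: projT2 (cid (ex_orient e)). Qed.

Definition z_point (G : graph) (Phi : gains F G) (e : edge G) :
    PG hF (coord_space (node G)) :=
  Pt (coord_neq0 (gain Phi e (orient e).1 (orient e).2) (proj1 (orientP e))).

Definition std_z (G : graph) (f : edge (merge_parallel G)) :
    PG hF (coord_space (node G)) :=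
  Pt (coord_neq0 0 (proj1 (orientP f))).

Lemma joins_orient (G : graph) (e : edge G) (v w : node G) : joins e v w ->
  orient e = (v, w) \/ orient e = (w, v).
Proof.
move=> [vw E]; have := orientP e; case: (orient e) => a b /= [ab].
rewrite E => E'.
have : [set a; b] a by left.
have : [set a; b] b by right.
by rewrite -E' => -[] bE [] aE; rewrite bE aE in ab *; by [|left|right].
Qed.

Lemma Pt_opp (V : lmodType F) (x y : V) (hx : x != 0) (hy : y != 0) :
  y = - x -> Pt hx = Pt hy.
Proof.
by move=> E; apply: (Pt_eq hF _ _ hy (_ : y = -1 *: x)) => //; rewrite scaleN1r.
Qed.

Lemma z_pointE (G : graph) (Phi : gains F G) (e : edge G) (v w : node G)
  (h : joins e v w) : z_point Phi e = Pt (coord_neq0 (gain Phi e v w) (proj1 h)).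
Proof.
rewrite /z_point; case: (joins_orient h) => E.
  by apply: val_inj; rewrite /= E.
by apply: Pt_opp; rewrite E /= (gain_opp Phi h) -[RHS]/(_, _) /= opprK opprB.
Qed.

Lemma std_zE (G : graph) (f : edge (merge_parallel G)) (v w : node G)
  (h : @joins (merge_parallel G) f v w) : std_z f = Pt (coord_neq0 0 (proj1 h)).
Proof.
rewrite /std_z; case: (joins_orient h) => E.
  by apply: val_inj; rewrite /= E.
by apply: Pt_opp; rewrite E -[RHS]/(_, _) /= oppr0 opprB.
Qed.

End Coordinates.

Arguments std_e0 {F} hF N.
Arguments std_hyperplane {F} hF N.
Arguments std_z {F} hF {G} f.
Arguments z_point {F} hF {G} Phi e.

(* Main.v *)
Require Import Defs.
From HB Require Import structures.
From mathcomp Require Import all_boot all_order all_algebra.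
From mathcomp Require Import all_classical.
From mathcomp Require Import zify.

(* For (a): a potential theta on the nodes extends to a linear functional on F^N
   sending each unit vector v to theta v. Indicators of one side of a cut show
   that the vectors of a forest are independent, and a potential for the gains
   along a circle of gain sum 0 separates e_0 from the span of the circle.

   For (b): choose vectors y_f for the points z'(f). For each node v there is a
   linear functional l_v with l_v(y_f) <> 0 exactly when f is incident with v.
   The linear relation along a circle shows that the ratios
   - l_w(y_f)^-1 l_v(y_f) multiply to 1 around circles, so the l_v can be rescaled
   to satisfy l_v(y_f) = - l_w(y_f) for every f = vw. Then (l_v)_v maps each y_f
   to a multiple of w - v and is injective on their span. Adding the functional
   that vanishes on the hyperplane and is 1 on e_0 gives the coordinates Psi;
   enlarging the space to F^(1+N) x V makes them injective on all of V. *)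

Set Implicit Arguments.
Unset Strict Implicit.
Unset Printing Implicit Defensive.

Import GRing.Theory.
Local Open Scope classical_set_scope.
Local Open Scope ring_scope.

(** * Linear spans and extension of linear maps *)

Section LinearSpan.
Variables (F : unitRingType) (V : lmodType F).

Definition subspace (W : set V) : Prop :=
  W 0 /\ forall (c : F) x y, W x -> W y -> W (c *: x + y).

(** An intersection like [Span], so that the two compare by exchanging flats and subspaces, without
    finite sums. *)
Definition lspan (A : set V) : set V :=
  [set x | forall W, subspace W -> A `<=` W -> W x].

Lemma subspaceZ (W : set V) c x : subspace W -> W x -> W (c *: x).
Proof. by move=> [W0 WZ] Wx; rewrite -[_ *: _]addr0; apply: WZ. Qed.

Lemma subspaceD (W : set V) x y : subspace W -> W x -> W y -> W (x + y).
Proof. by move=> [W0 WZ] Wx Wy; rewrite -[x]scale1r; apply: WZ. Qed.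

Lemma subspace_sum (W : set V) (I : Type) (r : seq I) (P : pred I) (f : I -> V) :
  subspace W -> (forall i, P i -> W (f i)) -> W (\sum_(i <- r | P i) f i).
Proof.
move=> sW Wf; elim/big_ind : _ => //; first by case: sW.
by move=> x y; exact: subspaceD.
Qed.

Lemma lspan_subspace (A : set V) : subspace (lspan A).
Proof.
split=> [W [W0 _] _ //|c x y Ax Ay W sW AW].
by case: (sW) => _; apply; [exact: Ax|exact: Ay].
Qed.

Lemma sub_lspan (A : set V) : A `<=` lspan A.
Proof. by move=> x Ax W _; apply. Qed.

Lemma lspan_le (A W : set V) : subspace W -> A `<=` W -> lspan A `<=` W.
Proof. by move=> sW AW x; apply. Qed.

Lemma lspanS (A B : set V) : A `<=` B -> lspan A `<=` lspan B.
Proof.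
move=> AB; apply: lspan_le; first exact: lspan_subspace.
exact: subset_trans AB (@sub_lspan B).
Qed.

(* Finitely many terms, without a canonical list of them: the same value is
   obtained by summing over any sufficiently large list. *)
Lemma lspan_sumP (E : choiceType) (y : E -> V) (A : set E) (x : V) :
  lspan (y @` A) x -> exists (c : E -> F) (s : seq E),
    (forall e, c e != 0 -> A e) /\
    forall t, uniq t -> {subset s <= t} -> x = \sum_(e <- t) c e *: y e.
Proof.
move: x; apply: lspan_le.
  split; first by exists (fun=> 0), [::]; split=> [e|t _ _]; rewrite ?eqxx //;
    rewrite big1 // => e _; rewrite scale0r.
  move=> a x x' [c [s [cA cE]]] [c' [s' [c'A c'E]]].
  exists (fun e => a * c e + c' e), (s ++ s'); split.
    move=> e; have [->|/cA//] := eqVneq (c e) 0.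
    by rewrite mulr0 add0r; exact: c'A.
  move=> t ut st; rewrite (cE t) // => [|e es]; last by apply: st; rewrite mem_cat es.
  rewrite (c'E t) // => [|e es]; last by apply: st; rewrite mem_cat es orbT.
  rewrite scaler_sumr -big_split /=; apply: eq_bigr => e _.
  by rewrite scalerA scalerDl.
move=> _ [f Af <-]; exists (fun e => (e == f)%:R), [:: f]; split.
  by move=> e; have [->//|] := eqVneq e f; rewrite eqxx.
move=> t ut /(_ f); rewrite mem_seq1 eqxx => /(_ isT) ft.
rewrite (bigD1_seq f) //= eqxx scale1r big1 ?addr0 // => e /negPf ->.
by rewrite scale0r.
Qed.

Lemma lspan_ordP (n : nat) (y : 'I_n -> V) (P : pred 'I_n) (x : V) :
  lspan (y @` [set i | P i]) x ->
  exists c : 'I_n -> F, x = \sum_(i < n | P i) c i *: y i.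
Proof.
move=> /lspan_sumP[c [s [cP cE]]]; exists c.
rewrite (cE (enum 'I_n)) ?enum_uniq //; last by move=> i; rewrite mem_enum.
rewrite big_enum /= (bigID P) /= addrC big1 ?add0r // => i nPi.
have [->|/cP/=] := eqVneq (c i) 0; first by rewrite scale0r.
by rewrite (negPf nPi).
Qed.

(** Independence of a family, not of a set of vectors: a vector repeated at two indices of [A]
    counts as a dependence. *)
Definition lin_indep (E : Type) (y : E -> V) (A : set E) : Prop :=
  forall e, A e -> ~ lspan (y @` (A `\ e)) (y e).

(* A spanning set of minimal size is independent. *)
Lemma lspan_indep_sub (E : Type) (y : E -> V) (A : set E) (x : V) :
  lspan (y @` A) x -> exists S : set E,
    [/\ S `<=` A, lin_indep y S & lspan (y @` S) x].
Proof.
move=> Ax.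
pose Q n := exists s : seq {classic E}, [/\ size s = n,
  (forall e : {classic E}, e \in s -> A e)
  & lspan (y @` [set e : E | (e : {classic E}) \in s]) x].
have exQ : exists n, `[< Q n >].
  have [c [s [cA cE]]] := @lspan_sumP {classic E} y A x Ax.
  pose t := [seq e <- undup s | c e != 0].
  exists (size t); apply/asboolP; exists t; split=> // [e|].
    by rewrite mem_filter => /andP[/cA].
  rewrite (cE (undup s)) ?undup_uniq //; last by move=> e; rewrite mem_undup.
  rewrite big_seq; apply: (subspace_sum _ (lspan_subspace _)) => e es.
  have [->|ce] := eqVneq (c e) 0.
    by rewrite scale0r; case: (lspan_subspace (y @` [set e : E | (e : {classic E}) \in t])).
  apply: (subspaceZ _ (lspan_subspace _)); apply: sub_lspan; exists e => //=.
  by rewrite mem_filter ce.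
case: (ex_minnP exQ) => m /asboolP[s [sm sA sx]] mmin.
exists [set e : E | (e : {classic E}) \in s]; split=> //= e es ye.
have /mmin : `[< Q (size [seq f <- s | f != (e : {classic E})]) >].
  apply/asboolP; exists ([seq f <- s | f != (e : {classic E})]).
  split=> // [f|]; first by rewrite mem_filter => /andP[_ /sA].
  move: sx; apply: lspan_le; first exact: lspan_subspace.
  move=> _ [f fs <-]; have [fe|fe] := eqVneq (f : {classic E}) e.
    rewrite fe; move: ye; apply: lspanS => _ [g [/= gs ge] <-].
    by exists g => //=; rewrite mem_filter /= gs andbT; apply/eqP.
  by apply: sub_lspan; exists f => //=; rewrite mem_filter /= fe.
rewrite -sm size_filter -(count_predC (predC1 (e : {classic E})) s).
rewrite -[X in (_ <= X)%N]addn0 leq_add2l leqn0 => /eqP/eqP.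
rewrite eqn0Ngt -has_count => /negP; apply; apply/hasP.
by exists e => //=; rewrite negbK.
Qed.

End LinearSpan.

Lemma lspan_image (F : unitRingType) (V W : lmodType F) (f : {linear V -> W})
    (A : set V) (x : V) : lspan A x -> lspan (f @` A) (f x).
Proof.
move: x; apply: (lspan_le (W := [set x | lspan (f @` A) (f x)])).
  split=> [|c x y /= Ax Ay]; first by rewrite /= linear0; case: (lspan_subspace (f @` A)).
  by rewrite linearP; case: (lspan_subspace (f @` A)) => _; apply.
by move=> x Ax; apply: sub_lspan; exists x.
Qed.

Section Extension.
Variables (F : unitRingType) (hF : GRing.field_axiom F) (V U : lmodType F).

(** Maps are handled through their graphs, so that extending a map means enlarging a subspace of
    [V * U]. *)
Lemma linear_of_rel (L : set (V * U)%type) : subspace L ->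
  (forall u, L (0, u) -> u = 0) -> (forall x, exists u, L (x, u)) ->
  exists g : {linear V -> U}, forall x u, L (x, u) -> g x = u.
Proof.
move=> sL fL /choice[g gL].
have Luniq x u u' : L (x, u) -> L (x, u') -> u = u'.
  move=> Lu Lu'; apply/eqP; rewrite -subr_eq0; apply/eqP/fL.
  have := sL.2 (-1) _ _ Lu' Lu; rewrite scaleN1r.
  by congr (L _); rewrite -[LHS]/(_, _) /= addNr addrC.
have glin : linear g.
  move=> a x y; apply: Luniq (gL _) _.
  exact: (sL.2 a _ _ (gL x) (gL y)).
pose G : {linear V -> U} := HB.pack g (GRing.isLinear.Build F V U _ g glin).
by exists G => x u Lu; apply: Luniq (gL x) Lu.
Qed.

(** Zorn's lemma on the single-valued subspaces containing [L]: a maximal one has full domain, hence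
    is the graph of a linear map. *)
Lemma linear_extension (L : set (V * U)%type) : subspace L ->
  (forall u, L (0, u) -> u = 0) ->
  exists g : {linear V -> U}, forall x u, L (x, u) -> g x = u.
Proof.
move=> sL fL.
pose P (X : set (V * U)%type) := X = set0 \/
  [/\ L `<=` X, subspace X & forall u, X (0, u) -> u = 0].
have [|M [PM Mmax]] := @Zorn_bigcup _ P.
  move=> C CP Ctot; have [[X CX [p Xp]]|noX] := pselect (exists2 X, C X & X !=set0);
    last first.
    left; rewrite -subset0 => p [X CX Xp]; apply: noX.
    by exists X => //; exists p.
  have good Y q : C Y -> Y q -> [/\ L `<=` Y, subspace Y & forall u, Y (0, u) -> u = 0].
    by move=> /CP[->//|].
  right; have [LX sX _] := good X p CX Xp; split.
  - by move=> q /LX Xq; exists X.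
  - split; first by exists X => //; exact: sX.1.
    move=> c q r [Y CY Yq] [Z CZ Zr].
    have [YZ|ZY] := Ctot Y Z CY CZ.
      by exists Z => //; have [_ sZ _] := good Z r CZ Zr; apply: sZ.2 => //; exact: YZ.
    by exists Y => //; have [_ sY _] := good Y q CY Yq; apply: sY.2 => //; exact: ZY.
  - by move=> u [Y CY Yu]; have [_ _] := good Y _ CY Yu; apply.
have [LM sM fM] : [/\ L `<=` M, subspace M & forall u, M (0, u) -> u = 0].
  case: PM => // M0; exfalso; apply: (Mmax L); last by right; split.
  rewrite M0; split; first by [].
  by move=> /(_ 0 sL.1).
have [g gM] : exists g : {linear V -> U}, forall x u, M (x, u) -> g x = u.
  apply: linear_of_rel => // x; apply: contrapT => nx.
  (* Adjoin [(x, 0)]. If the result were not single-valued, [x] would already lie in the domain of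
     [M]. *)
  pose M' := [set q : (V * U)%type | exists (a : F) (r : (V * U)%type),
    M r /\ q = a *: (x, 0) + r].
  apply: (Mmax M'); last first.
    right; split.
    - by move=> q /LM Mq; exists 0, q; rewrite scale0r add0r.
    - split; first by exists 0, 0; rewrite scale0r addr0; split=> //; exact: sM.1.
      move=> c _ _ [a [r [Mr ->]]] [a' [r' [Mr' ->]]].
      exists (c * a + a'), (c *: r + r'); split; first exact: sM.2.
      by rewrite scalerDr scalerA scalerDl addrACA.
    - move=> u [a [[r1 r2] [Mr]]]; rewrite -[RHS]/(_, _) /= => -[].
      move=> /esym/eqP; rewrite addrC addr_eq0 => /eqP rE uE.
      have [a0|a0] := eqVneq a 0.
        move: rE Mr; rewrite uE a0 scale0r oppr0 scaler0 add0r => ->; exact: fM.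
      exfalso; apply: nx; exists (- a^-1 *: r2).
      have := subspaceZ (- a^-1) sM Mr; rewrite -[_ *: (_, _)]/(_, _) /= rE.
      by rewrite scalerN scaleNr opprK scalerA mulVr ?hF // scale1r.
  split.
    by move=> q Mq; exists 0, q; rewrite scale0r add0r.
  move=> /(_ (x, 0)) sub; apply: nx; exists 0; apply: sub.
  by exists 1, 0; rewrite scale1r addr0; split=> //; exact: sM.1.
by exists g => x u /LM; exact: gM.
Qed.

(** In a linear relation among the [y e], an index with nonzero prescribed value must have
    coefficient zero, so the values satisfy the same relation. Where the value is 0, [y] may be
    dependent; [node_functional] relies on this. *)
Lemma linear_ext_family (E : Type) (y : E -> V) (Y : E -> U) (A : set E) :
  (forall e, A e -> Y e <> 0 -> ~ lspan (y @` (A `\ e)) (y e)) ->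
  exists g : {linear V -> U}, forall e, A e -> g (y e) = Y e.
Proof.
move=> yA; pose z (e : {classic E}) : (V * U)%type := (y e, Y e).
have [u|g gE] := linear_extension (lspan_subspace (z @` A)).
  move=> /(@lspan_sumP _ _ {classic E} z A)[c [s [cA cE]]].
  pose t := undup s.
  have st : {subset s <= t} by move=> e; rewrite mem_undup.
  have E0 := cE t (undup_uniq s) st.
  have /esym y0 : 0 = \sum_(e <- t) c e *: y e.
    by have := congr1 fst E0; rewrite /= raddf_sum.
  have -> : u = \sum_(e <- t) c e *: Y e.
    by have := congr1 snd E0; rewrite /= raddf_sum.
  rewrite big_seq big1 // => e et.
  have [->|ce] := eqVneq (c e) 0; first by rewrite scale0r.
  have [->|/eqP Ye] := eqVneq (Y e) 0; first by rewrite scaler0.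
  exfalso; apply: (yA e (cA _ ce) Ye).
  move: y0; rewrite (bigD1_seq e) ?undup_uniq //= => /eqP.
  rewrite addr_eq0 => /eqP/(scalerVK hF ce) ->.
  apply: (subspaceZ _ (lspan_subspace _)); rewrite -scaleN1r.
  apply: (subspaceZ _ (lspan_subspace _)).
  apply: (subspace_sum _ (lspan_subspace _)) => f fe.
  have [->|cf] := eqVneq (c f) 0.
    by rewrite scale0r; case: (lspan_subspace (y @` (A `\ e))).
  apply: (subspaceZ _ (lspan_subspace _)); apply: sub_lspan; exists f => //.
  by split=> [|/= fE]; [exact: cA|move: fe; rewrite fE eqxx].
by exists g => e Ae; apply: gE; apply: sub_lspan; exists e.
Qed.

End Extension.

(** * Walks and circles *)

Section Walks.
Variables (T : Type) (r : T -> T -> Prop).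

(** The reflexive transitive closure of [r], encoded by closed sets so that an invariant set applies
    without induction on a walk. *)
Definition conn (u w : T) : Prop :=
  forall X : set T, X u -> (forall x y, X x -> r x y -> X y) -> X w.

Lemma conn_refl u : conn u u. Proof. by move=> X. Qed.

Lemma conn_step u x y : conn u x -> r x y -> conn u y.
Proof. by move=> ux xy X Xu Xr; exact: Xr (ux X Xu Xr) xy. Qed.

Lemma conn_trans u x y : conn u x -> conn x y -> conn u y.
Proof. by move=> ux xy X Xu Xr; exact: xy (ux X Xu Xr) Xr. Qed.

Lemma conn_sym u w : (forall x y, r x y -> r y x) -> conn u w -> conn w u.
Proof.
move=> rC uw; apply: (uw (fun x => conn x u)); first exact: conn_refl.
move=> x y xu /rC yx; apply: conn_trans xu.
by apply: conn_step yx; exact: conn_refl.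
Qed.

Definition walk (n : nat) (p : nat -> T) : Prop :=
  forall m, (m < n)%N -> r (p m) (p m.+1).

(** The stretch between two visits to the same point is cut out and the rest is shifted down by
    [j - i]. *)
Lemma walk_cut n p i j : walk n p -> (i <= j <= n)%N -> p i = p j ->
  exists q, [/\ walk (n - (j - i)) q, q 0%N = p 0%N & q (n - (j - i))%N = p n].
Proof.
move=> wp ijn pij; exists (fun m => if (m <= i)%N then p m else p (m + (j - i))%N).
split=> //.
- move=> m mn; have [mi|im] := leqP m.+1 i; first by rewrite ltnW //; apply: wp; lia.
  have [mi|mi] := leqP m i.
    have <- : i = m by lia.
    by rewrite pij (_ : (i.+1 + (j - i) = j.+1)%N); [apply: wp; lia|lia].
  by rewrite (_ : (m.+1 + (j - i) = (m + (j - i)).+1)%N); [apply: wp; lia|lia].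
- case: ifP => h; last by congr p; lia.
  by rewrite (_ : (n - (j - i) = i)%N) ?pij; [congr p; lia|lia].
Qed.

(** A shortest walk repeats no point, since [walk_cut] would shorten it. *)
Lemma conn_simple_walk u w : conn u w -> exists n p,
  [/\ walk n p, p 0%N = u, p n = w
    & forall i j, (i <= n)%N -> (j <= n)%N -> p i = p j -> i = j].
Proof.
move=> uw; pose Q n := exists p, [/\ walk n p, p 0%N = u & p n = w].
have exQ : exists n, `[< Q n >].
  apply: (uw (fun w => exists n, `[< exists p, [/\ walk n p, p 0%N = u & p n = w] >])).
    by exists 0%N; apply/asboolP; exists (fun=> u).
  move=> x y [n /asboolP[p [wp p0 pn]]] xy; exists n.+1; apply/asboolP.
  exists (fun m => if (m <= n)%N then p m else y); split=> //; last by rewrite ltnn.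
  move=> m; rewrite ltnS leq_eqVlt => /orP[/eqP ->|mn] /=.
    by rewrite eqxx ltnn pn.
  by rewrite mn orbT; exact: wp.
case: (ex_minnP exQ) => n /asboolP[p [wp p0 pn]] nmin.
have inj i j : (i < j)%N -> (j <= n)%N -> p i <> p j.
  move=> ij jn pij; have [|q [wq q0 qn]] := walk_cut wp _ pij; first by lia.
  have /nmin : `[< Q (n - (j - i))%N >] by apply/asboolP; exists q; rewrite q0 qn.
  lia.
exists n, p; split=> // i j hi hj pij; have [ij|ji|//] := ltngtP i j.
- by case: (inj i j).
- by case: (inj j i).
Qed.

End Walks.

Section Graphs.
Variable G : graph.
Implicit Types (v w : node G) (e f g : edge G) (C S : set (edge G)).

Lemma joinsC e v w : joins e v w -> joins e w v.
Proof. by move=> [vw E]; split; [move/esym|rewrite E setUC]. Qed.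

Lemma joins_ends e v w : joins e v w -> ends e v /\ ends e w.
Proof. by move=> [_ ->]; split; [left|right]. Qed.

Lemma joins_inv e v w v' w' : joins e v w -> joins e v' w' ->
  (v' = v /\ w' = w) \/ (v' = w /\ w' = v).
Proof.
move=> [vw E] /[dup] j /joins_ends; case: j => vw' _; rewrite E.
by move=> [[] vE [] wE]; rewrite ?vE ?wE in vw' *; by [left|right|case: vw'].
Qed.

Lemma joins_other e v w w' : joins e v w -> joins e v w' -> w' = w.
Proof. by move=> j /(joins_inv j)[[_ //]|[vw _]]; case: j => /(_ vw). Qed.

Lemma telescope_cycle (R : zmodType) k (th : 'I_k -> R) :
  \sum_(i < k) (th (ordS i) - th i) = 0.
Proof.
rewrite sumrB [X in _ - X](reindex_inj (@ordS_inj k)); exact: subrr.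
Qed.

(** Differences of the indicator of [X] sum to 0 around a circle, so a circle cannot cross the
    boundary of [X] exactly once. *)
Lemma circle_cut C (X : set (node G)) f u w : circle C -> C f -> joins f u w ->
  X u -> ~ X w ->
  (forall g x y, C g -> g <> f -> joins g x y -> X x -> X y) -> False.
Proof.
move=> [k [v [e [[k1 vI eI ve] ->]]]] [i _ <-{f}] jf Xu Xw noX.
have := telescope_cycle (fun m => (`[< X (v m) >])%:R : int).
rewrite (bigD1 i) //= big1 => [|j ji]; last first.
  apply/eqP; rewrite subr_eq0; apply/eqP; congr (nat_of_bool _)%:R.
  apply/asbool_equiv_eq; have ej : e j <> e i by move/eI/eqP; rewrite (negPf ji).
  by split; apply: noX ej _; [exists j|exact: joinsC|exists j|].
rewrite addr0 => /eqP; rewrite subr_eq0 => /eqP.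
have [[-> ->]|[-> ->]] := joins_inv jf (ve i).
  by rewrite asboolF // asboolT.
by rewrite asboolT // asboolF.
Qed.

Definition estep S v w : Prop := exists2 e, S e & joins e v w.

Lemma estep_sym S v w : estep S v w -> estep S w v.
Proof. by move=> [e Se /joinsC]; exists e. Qed.

(** A simple path in [S] between the ends of [f] closes up with [f]. *)
Lemma circle_of_conn S f u w : joins f u w -> ~ S f -> conn (estep S) u w ->
  exists2 C, circle C & C f /\ C `<=` f |` S.
Proof.
move=> jf Sf uw; have [n [p [wp p0 pn pI]]] := conn_simple_walk uw.
have /choice[E EP] m : exists e, (m < n)%N -> S e /\ joins e (p m) (p m.+1).
  have [mn|nm] := ltnP m n; last by exists f.
  by have [e Se je] := wp m mn; exists e.
pose v (i : 'I_n.+1) := p i.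
(* The path uses the indices below [n]; the last index [n] carries the closing edge [f]. *)
pose e (i : 'I_n.+1) := if (i < n)%N then E i else f.
have n0 : (0 < n)%N.
  rewrite lt0n; apply/eqP => n0; case: jf => + _; apply.
  by rewrite -p0 -pn n0.
have ve i : joins (e i) (v i) (v (ordS i)).
  rewrite /e /v /=; have := ltn_ord i; rewrite ltnS leq_eqVlt => /orP[/eqP iE|iN].
    by rewrite iE ltnn modnn p0 pn; exact: joinsC.
  by rewrite iN modn_small ?ltnS //; exact: (EP i iN).2.
have eI (i j : 'I_n.+1) : (i < j)%N -> e i <> e j.
  move=> ij; have jn : (j <= n)%N by rewrite -ltnS.
  have iN : (i < n)%N by lia.
  have [Se je] := EP i iN.
  rewrite /e iN; case: ifP => jN eij; last by apply: Sf; rewrite -eij.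
  have [Sj] := EP j jN; rewrite -eij => /(joins_inv je)[[] /pI|[] _ /pI]; lia.
exists (range e); first (exists n.+1, v, e; split=> //; split=> //).
- by move=> i j /pI ij; apply/val_inj/ij; rewrite -ltnS.
- move=> i j eij; apply/val_inj; have [ij|ji|//] := ltngtP (val i) (val j).
    by case: (eI i j).
  by case: (eI j i).
split; first by exists ord_max => //; rewrite /e /= ltnn.
move=> _ [i _ <-]; rewrite /e; case: ifP => iN; last by left.
by right; exact: (EP i iN).1.
Qed.

(* A circle contained in C minus f would have an edge g; but C minus {f, g}
   consists of two paths, and f, g are the only edges of C leaving one of them. *)
Lemma circle_minimal C f : circle C -> C f -> graphic_indep (C `\ f).
Proof.
move=> [k [v [e [[k1 vI eI ve] ->]]]] [i _ <-{f}] [C' cC' C'C].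
have [k' [v' [e' [[k1' _ _ ve'] C'E]]]] := cC'.
have [g C'g] : exists g, C' g.
  by exists (e' (Ordinal (ltnW k1'))); rewrite C'E; exists (Ordinal (ltnW k1')).
have [[j _ jg] gi] := C'C g C'g.
have ji : j <> i by move=> ji; apply: gi; rewrite -jg ji.
(* Position along the circle counted from the node after [i], so that the deleted edge [e i] joins
   the last position to position 0. *)
pose pos (m : 'I_k) := ((m + (k - i.+1)) %% k)%N.
have ik := ltn_ord i.
have posE (m : 'I_k) : pos m = if (m <= i)%N then (m + (k - i.+1))%N else (m - i.+1)%N.
  have mk := ltn_ord m; rewrite /pos; case: ifP => mi; first by rewrite modn_small //; lia.
  rewrite (_ : (m + (k - i.+1) = (m - i.+1) + k)%N); last by lia.
  by rewrite modnDr modn_small //; lia.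
have posI m m' : pos m = pos m' -> m = m'.
  rewrite !posE => E; apply: val_inj => /=; move: E.
  have := ltn_ord m; have := ltn_ord m'; case: ifP; case: ifP; lia.
have posS m : m <> i -> pos (ordS m) = (pos m).+1.
  move=> mi; have mi' : (m : nat) <> i by move/val_inj.
  rewrite !posE /=; have mk := ltn_ord m.
  have [mE|mk'] := eqVneq m.+1 k; first by rewrite mE modnn /=; case: ifP; lia.
  by rewrite modn_small; last lia; case: ifP; case: ifP; lia.
have posSi : pos (ordS i) = 0%N.
  rewrite posE /=; have [iE|mk'] := eqVneq i.+1 k.
    by rewrite iE modnn /=; lia.
  by rewrite modn_small; last lia; case: ifP; lia.
(* The arc from the node after [i] up to [v j]. The circle leaves it only by [e i], which is not in
   [C'], and by [g]. *)
pose X := [set x | exists2 m, v m = x & (pos m <= pos j)%N].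
apply: (@circle_cut C' X g (v j) (v (ordS j)) cC' C'g); first by rewrite -jg; exact: ve.
- by exists j.
- move=> [m /vI ->]; rewrite posS //; lia.
move=> h x y C'h hg jh [m mx mj].
have [[l _ lh] hi] := C'C h C'h.
have li : l <> i by move=> li; apply: hi; rewrite -lh li.
have lj : pos l <> pos j by move=> /posI lj; apply: hg; rewrite -lh lj jg.
have := ve l; rewrite lh => /(joins_inv jh)[[vx vy]|[vy vx]].
  exists (ordS l) => //; rewrite posS //.
  by move: vx; rewrite -mx => /vI E; move: mj lj; rewrite -E; lia.
exists l => //; move: vx; rewrite -mx => /vI E; move: mj; rewrite -E posS //; lia.
Qed.

End Graphs.

Lemma circle_iso (G1 G2 : graph) (a : node G1 -> node G2) (b : edge G1 -> edge G2)
    (C : set (edge G1)) : bijective a -> bijective b ->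
  (forall e, ends (b e) = a @` ends e) -> circle C <-> circle (b @` C).
Proof.
move=> [a' aK a'K] [b' bK b'K] ab.
have aI := can_inj aK; have bI := can_inj bK.
have joinsE e v w : joins (b e) (a v) (a w) <-> joins e v w.
  rewrite /joins ab; split=> -[vw E]; split.
  - by move=> E'; apply: vw; rewrite E'.
  - apply/seteqP; split=> x.
      move=> ex; have : (a @` ends e) (a x) by exists x.
      by rewrite E => -[/aI->|/aI->]; [left|right].
    by move=> [->|->]; [have : [set a v; a w] (a v) by left
      |have : [set a v; a w] (a w) by right]; rewrite -E => -[y ey /aI <-].
  - by move/aI.
  - by rewrite E image_setU !image_set1.
split=> -[k [v [e [[k1 vI eI ve] CE]]]].
  exists k, (a \o v), (b \o e); split; last by rewrite CE image_comp.
  split=> //; [exact: inj_comp|exact: inj_comp|].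
  by move=> i; apply/joinsE; exact: ve.
exists k, (a' \o v), (b' \o e); split.
  split=> //.
  - exact: inj_comp (can_inj a'K) vI.
  - exact: inj_comp (can_inj b'K) eI.
  - by move=> i; apply/joinsE; rewrite /= b'K !a'K; exact: ve.
apply/seteqP; split=> [c Cc|_ [i _ <-] /=].
  have : (b @` C) (b c) by exists c.
  by rewrite CE => -[i _ ei]; exists i => //=; rewrite ei bK.
have : range e (e i) by exists i.
by rewrite -CE => -[c Cc <-]; rewrite bK.
Qed.

(** * Projective and linear spans; gain sums along circles *)

Section SpanLspan.
Variables (F : unitRingType) (hF : GRing.field_axiom F) (V : lmodType F).
Implicit Types (p q : pg_point V) (S : set (PG hF V)) (x y : V).

Lemma span1_neq0 p x : val p = span1 x -> x != 0.
Proof.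
have [u u0 ->] := pg_pointP p => E; apply: contraNneq u0 => x0.
have := span1_id u; rewrite E => -[a _ <-]; rewrite x0 scaler0 //.
Qed.

Lemma point_span1 p x : val p x -> x != 0 -> val p = span1 x.
Proof.
have [u u0 pu] := pg_pointP p; rewrite pu => -[a _ ax] x0.
by rewrite -pu (Pt_eq hF pu (erefl : val (Pt x0) = span1 x) x0 (esym ax)).
Qed.

Lemma pointZ p c x : val p x -> val p (c *: x).
Proof.
have [u _ ->] := pg_pointP p; move=> [a _ <-].
by exists (c * a) => //; rewrite scalerA.
Qed.

(** The vectors on the points of [S]. Zero is added so that the empty flat, too, gives a
    subspace. *)
Definition vecs S : set V := [set x | x = 0 \/ exists2 p, S p & val p x].

Lemma vecsP S p x : val p = span1 x -> S p <-> vecs S x.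
Proof.
move=> px; split=> [Sp|[x0|[q Sq qx]]].
- by right; exists p => //; rewrite px; exact: span1_id.
- by have := span1_neq0 px; rewrite x0 eqxx.
- suff -> : p = q by []; apply: val_inj.
  by rewrite px (point_span1 qx (span1_neq0 px)).
Qed.

(** Vectors of two distinct points combine to a vector of a point on their line; the other cases
    have a zero vector or a single point. *)
Lemma flat_subspace S : flat S -> subspace (vecs S).
Proof.
move=> fS; split; first by left.
move=> c x y [->|[p Sp px]] vy; first by rewrite scaler0 add0r.
case: vy => [->|[q Sq qy]].
  by rewrite addr0; right; exists p => //; exact: pointZ.
have [->|s0] := eqVneq (c *: x + y) 0; first by left.
have [x0|x0] := eqVneq x 0; first by rewrite x0 scaler0 add0r; right; exists q.
have [y0|y0] := eqVneq y 0.
  by rewrite y0 addr0; right; exists p => //; exact: pointZ.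
have [pE qE] := (point_span1 px x0, point_span1 qy y0).
right; have [pq|pq] := pselect (p = q).
  exists p => //; move: qy; rewrite -pq pE => -[a _ <-].
  by exists (c + a) => //; rewrite scalerDl.
exists (Pt s0); last exact: span1_id.
have lpq : pg_lines (pg_join p q) by exists p, q.
have sub := fS _ p q lpq pq (@pg_join_l _ _ p q) (@pg_join_r _ _ p q) Sp Sq.
apply: (sub (Pt s0)); apply/(pg_joinP pE qE (erefl : val (Pt s0) = span1 (c *: x + y))).
by exists c, 1; rewrite scale1r.
Qed.

Lemma subspace_flat (W : set V) : subspace W ->
  flat ([set p | val p `<=` W] : set (PG hF V)).
Proof.
move=> sW L p q hL pq Lp Lq /= pW qW r.
rewrite (pg_line_eq hF pq hL Lp Lq).
have [x _ px] := pg_pointP p; have [y _ qy] := pg_pointP q.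
have [t _ rt] := pg_pointP r.
move=> /(pg_joinP px qy rt)[a [b tE]] /=; rewrite rt => _ [c _ <-].
apply: subspaceZ => //; rewrite tE; apply: sW.2.
  by apply: pW; rewrite px; exact: span1_id.
by apply: subspaceZ => //; apply: qW; rewrite qy; exact: span1_id.
Qed.

Lemma span1_sub (W : set V) x : subspace W -> W x -> span1 x `<=` W.
Proof. by move=> sW Wx _ [a _ <-]; exact: subspaceZ. Qed.

Variables (E : Type) (z : E -> PG hF V) (y : E -> V).
Hypothesis zy : forall e, val (z e : pg_point V) = span1 (y e).

Lemma SpanP (A : set E) p x : val p = span1 x ->
  Span (z @` A) (p : PG hF V) <-> lspan (y @` A) x.
Proof.
move=> px; split=> [|yx T fT AT].
  move=> /(_ _ (subspace_flat (lspan_subspace (y @` A)))) /= pA.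
  suff: val p `<=` lspan (y @` A) by apply; rewrite px; exact: span1_id.
  apply: pA => _ [e Ae <-] /=; rewrite zy; apply: span1_sub.
    exact: lspan_subspace.
  by apply: sub_lspan; exists e.
apply/(vecsP T px); apply: (yx _ (flat_subspace fT)) => _ [e Ae <-].
by apply/(vecsP T (zy e)); apply: AT; exists e.
Qed.

Lemma proj_indepP (A : set E) : injective z ->
  proj_indep (z @` A) <-> lin_indep y A.
Proof.
move=> zI.
have DE e : (z @` A) `\ z e = z @` (A `\ e).
  apply/seteqP; split=> [_ [[f Af <-] fe]|_ [f [Af fe] <-]].
    by exists f => //; split=> // /= E'; apply: fe; rewrite /= E'.
  by split; [exists f|move=> /zI].
split=> [ind e Ae /(SpanP _ (zy e))|ind _ [e Ae <-]].
  by rewrite -DE; apply: ind; exists e.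
by rewrite DE => /(SpanP _ (zy e)); exact: ind.
Qed.

End SpanLspan.

(** * Unit vectors: functionals, supports, and independence of forests *)

Section Hat.
Variables (F : unitRingType) (hF : GRing.field_axiom F).

Lemma hatE (N : Type) (v u : N) : hat F v u = (`[< u = v >])%:R.
Proof. by []. Qed.

Lemma hatxx (N : Type) (v : N) : hat F v v = 1.
Proof. by rewrite hatE asboolT. Qed.

Lemma hat_neq (N : Type) (v u : N) : u <> v -> hat F v u = 0.
Proof. by move=> uv; rewrite hatE asboolF. Qed.

(** For infinite [N] the unit vectors do not span [N -> F], so the functional comes from their
    independence: the coordinate at [v] vanishes on all unit vectors but that of [v]. *)
Lemma hat_functional (N : Type) (th : N -> F) :
  exists g : {linear (N -> F^o) -> F^o}, forall v, g (hat F v) = th v.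
Proof.
have [v _ _|g gE] := linear_ext_family hF (y := @hat F N) (Y := th : N -> F^o)
  (A := setT); last by exists g => v; exact: gE.
pose W := [set x : N -> F^o | x v = 0].
have sW : subspace W.
  split=> // c x y /= xv yv.
  by rewrite /W /= -[LHS]/(c * x v + y v) xv yv mulr0 addr0.
move=> /(lspan_le sW) h; suff /h : [set hat F x | x in [set: N] `\ v] `<=` W.
  by rewrite /W /= hatxx => /eqP; rewrite oner_eq0.
by move=> _ [u [_ /= uv] <-]; rewrite /W /= hat_neq // => vu; apply: uv.
Qed.

Lemma hat_sub_neq0E (N : Type) (v w u : N) : v <> w ->
  (hat F w - hat F v) u != 0 <-> [set v; w] u.
Proof.
move=> vw; rewrite -[(_ - _) u]/(hat F w u - hat F v u).
split=> [|[->|->]].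
- apply: contra_neqP => /not_orP[uv uw].
  by rewrite !hat_neq // subrr.
- by rewrite hatxx hat_neq // sub0r oppr_eq0 oner_eq0.
- by rewrite hatxx hat_neq ?subr0 ?oner_eq0 // => wv; apply: vw.
Qed.

(** The support of a difference of two unit vectors is the pair of nodes, and a nonzero scalar
    preserves it. *)
Lemma hat_sub_ends (N : Type) (c : F) (v w v' w' : N) : v <> w -> v' <> w' ->
  hat F w - hat F v = c *: (hat F w' - hat F v') -> [set v; w] = [set v'; w'].
Proof.
move=> vw vw' E.
have c0 : c != 0.
  by apply: contraNneq (hat_sub_neq0 F vw) => c0; rewrite E c0 scale0r.
have cE x : (c * x != 0) = (x != 0).
  apply/idP/idP; apply: contraNneq; first by move=> ->; rewrite mulr0.
  move=> cx.
  by rewrite -[x]mul1r -(mulVr (hF c0)) -mulrA cx mulr0.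
apply/seteqP; split=> u.
  by move/(hat_sub_neq0E _ vw); rewrite E => h; apply/(hat_sub_neq0E _ vw'); rewrite -cE.
by move/(hat_sub_neq0E _ vw') => h; apply/(hat_sub_neq0E _ vw); rewrite E; rewrite -cE in h.
Qed.

Section Family.
Variables (G : graph) (V : lmodType F) (Lam : {linear V -> (node G -> F^o)}).
Variable y : edge G -> V.
Hypothesis yE : forall e v w, joins e v w ->
  exists2 s : F, s != 0 & Lam (y e) = s *: (hat F w - hat F v).

(* Deleting f from the forest S separates its ends; the coordinate sum over one
   side of this cut kills every other edge of S. *)
Lemma hat_lin_indep (S : set (edge G)) : graphic_indep S -> lin_indep y S.
Proof.
move=> indS f Sf; have [v [w [vw fE]]] := ends_link f; have jf : joins f v w by [].
pose X := conn (estep (S `\ f)) v.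
have Xw : ~ X w.
  move=> vSw; have [|C cC [Cf CS]] := circle_of_conn jf _ vSw; first by case=> _; apply.
  by apply: indS; exists C => // e /CS[->//|[]].
have [g gE] := hat_functional (fun u => (`[< X u >])%:R : F).
have kerE e : (g (Lam (y e)) = 0) <-> forall u u', joins e u u' -> X u -> X u'.
  have gs (s : F) u u' :
      g (s *: (hat F u' - hat F u)) = s * ((`[< X u' >])%:R - (`[< X u >])%:R).
    by rewrite linearZ linearB /= !gE.
  split=> [+ u u' j|h].
    have [s s0 ->] := yE j; rewrite gs => E Xu; apply: contrapT => Xu'.
    move: E; rewrite asboolF // asboolT // sub0r mulrN1 => /eqP.
    by rewrite oppr_eq0 (negPf s0).
  have [u [u' [uu' eE]]] := ends_link e; have j : joins e u u' by [].
  have [s s0 ->] := yE j; rewrite gs (_ : `[< X u >] = `[< X u' >]).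
    by rewrite subrr mulr0.
  by apply/asbool_equiv_eq; split; apply: h => //; exact: joinsC.
move=> /(lspan_image (f := Lam))/(lspan_image (f := g))/= yf.
have : g (Lam (y f)) = 0.
  apply: (lspan_le (W := [set x | x = 0])) yf => /=.
    by split=> // c a b /= -> ->; rewrite scaler0 addr0.
  move=> _ [_ [_ [e Se <-] <-] <-] /=; apply/kerE => u u' j Xu.
  by apply: conn_step Xu _; exists e.
by move=> /kerE/(_ v w jf) h; apply: Xw; apply: h; exact: conn_refl.
Qed.

End Family.

Lemma lspan_of_sum (V : lmodType F) (E : Type) (y : E -> V) k (e : 'I_k -> E)
    (c : 'I_k -> F) i : injective e -> c i != 0 ->
  \sum_(j < k) c j *: y (e j) = 0 -> lspan (y @` (range e `\ e i)) (y (e i)).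
Proof.
move=> eI ci; rewrite (bigD1 i) //= => /eqP; rewrite addr_eq0 => /eqP.
move=> /(scalerVK hF ci) ->; rewrite -scaleN1r scalerA.
apply: (subspaceZ _ (lspan_subspace _)).
apply: (subspace_sum _ (lspan_subspace _)) => j /eqP ji.
apply: (subspaceZ _ (lspan_subspace _)); apply: sub_lspan; exists (e j) => //.
by split; [exists j|move=> /eI].
Qed.

Definition edge_vec (G : graph) (a : F) (v w : node G) :
  coord_space F (node G) := (a, hat F w - hat F v).

(** * Balance of circles as a condition on spans, for vectors with given coordinates *)

Section Balance.
Variables (G : graph) (Phi : gains F G) (V : lmodType F).
Variables (Psi : {linear V -> coord_space F (node G)}) (t : edge G -> V) (x0 : V).
Hypothesis x0E : Psi x0 = (1, 0).
Hypothesis tE : forall e v w, joins e v w ->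
  exists2 s : F, s != 0 & Psi (t e) = s *: edge_vec (gain Phi e v w) v w.
Hypothesis Psi_inj : forall x, lspan (x0 |` range t) x -> Psi x = 0 -> x = 0.

(* If the gains around the circle sum to 0, they are differences of a potential,
   which yields a functional vanishing on the t e but not on x0; otherwise the
   normalized t e add up to a nonzero multiple of x0. *)
Lemma balanceP k (v : 'I_k -> node G) (e : 'I_k -> edge G) : circle_walk v e ->
  lspan (t @` range e) x0 <->
  \sum_(i < k) gain Phi (e i) (v i) (v (ordS i)) <> 0.
Proof.
move=> [k1 vI eI ve]; pose phi i := gain Phi (e i) (v i) (v (ordS i)).
split=> [x0C phi0|phi0].
  (* Minus the partial gain sum before [m]. Since the total is 0, the step relation [thS] also holds
     across the wrap-around. *)
  pose th (m : 'I_k) := - \sum_(j < k | (j < m)%N) phi j.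
  have thS m : phi m + (th (ordS m) - th m) = 0.
    rewrite /th /=; have mk := ltn_ord m.
    have [mE|mk'] := eqVneq m.+1 k.
      rewrite mE modnn big_pred0 // oppr0 sub0r opprK -[RHS]phi0 addrC.
      rewrite [RHS](bigD1 m) //= addrC; congr (_ + _); apply: eq_bigl => j.
      by rewrite -val_eqE /=; have := ltn_ord j; lia.
    rewrite modn_small; last lia.
    rewrite [X in - X](bigD1 m) //= opprK opprD.
    rewrite (eq_bigl (fun j : 'I_k => (j < m)%N)) ?subrK ?addrA ?subrr ?add0r ?addNr //.
    by move=> j; rewrite -val_eqE /=; lia.
  (* [theta] transfers [th] to the nodes of the circle, with default value 0 elsewhere. *)
  have /choice[theta thE] x : exists c, forall m, v m = x -> c = th m.
    have [[m mx]|nx] := pselect (exists m, v m = x); last first.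
      by exists 0 => m mx; case: nx; exists m.
    by exists (th m) => m'; rewrite -mx => /vI ->.
  have [g gE] := hat_functional theta.
  (* The kernel of a functional that vanishes on every [t (e i)] by [thS] and is 1 at [x0]. *)
  pose W := [set x : V | (Psi x).1 + g (Psi x).2 = 0].
  have sW : subspace W.
    split=> [|c x y]; first by rewrite /W /= !linear0 addr0.
    rewrite /W /= => xW yW.
    rewrite linearP -[(c *: Psi x + Psi y).1]/(c * (Psi x).1 + (Psi y).1).
    rewrite -[(c *: Psi x + Psi y).2]/(c *: (Psi x).2 + (Psi y).2) linearP.
    by rewrite addrACA -[c *: g _]/(c * g _) -mulrDr xW yW mulr0 addr0.
  have : W x0.
    apply: (lspan_le sW) x0C => _ [_ [i _ <-] <-]; rewrite /W /=.
    have [s s0 ->] := tE (ve i); rewrite -[(_ *: _).1]/(s * phi i).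
    rewrite -[(_ *: _).2]/(s *: (hat F (v (ordS i)) - hat F (v i))).
    rewrite linearZ linearB /= !gE -[s *: _]/(s * _) -mulrDr.
    by rewrite (thE _ _ erefl) (thE _ _ erefl) thS mulr0.
  by rewrite /W /= x0E /= linear0 addr0 => /eqP; rewrite oner_eq0.
have /choice[s sE] i : exists s : F, s != 0 /\
    Psi (t (e i)) = s *: edge_vec (phi i) (v i) (v (ordS i)).
  by have [s s0 E] := tE (ve i); exists s.
(* In coordinates the unit vectors telescope and leave the gain sum times that of [x0]; [Psi_inj]
   carries the equality back to [V]. *)
pose u := \sum_(i < k) (s i)^-1 *: t (e i).
pose gam := \sum_(i < k) phi i.
have uC : lspan (t @` range e) u.
  apply: (subspace_sum _ (lspan_subspace _)) => i _.
  apply: (subspaceZ _ (lspan_subspace _)); apply: sub_lspan.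
  by exists (e i) => //; exists i.
have uE : u = gam *: x0.
  apply/eqP; rewrite -subr_eq0; apply/eqP/Psi_inj.
    apply: (subspaceD (lspan_subspace _)).
      apply: lspanS uC => _ [f _ <-]; right; by exists f.
    rewrite -scaleNr; apply: (subspaceZ _ (lspan_subspace _)).
    by apply: sub_lspan; left.
  rewrite linearB linearZ /= x0E /u linear_sum /=.
  rewrite (eq_bigr (fun i => edge_vec (phi i) (v i) (v (ordS i)))); last first.
    by move=> i _; rewrite linearZ /= (sE i).2 scalerA mulVr ?scale1r ?hF ?(sE i).1.
  apply/eqP; rewrite subr_eq0; apply/eqP.
  rewrite [LHS]surjective_pairing !raddf_sum /=.
  rewrite (telescope_cycle (fun i => hat F (v i))).
  by rewrite -[RHS]/(gam * 1, gam *: 0) mulr1 scaler0.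
have gam0 : gam != 0 by apply/eqP.
rewrite (scalerVK hF gam0 (esym uE)).
exact: (subspaceZ _ (lspan_subspace _)).
Qed.

End Balance.

End Hat.

(** * The orthographic representation of a gain graph *)

Section Balanced.
Variables (F : unitRingType) (hF : GRing.field_axiom F).
Variables (G : graph) (Phi : gains F G) (V : lmodType F).
Variables (Psi : {linear V -> coord_space F (node G)}) (t : edge G -> V) (x0 : V).
Hypothesis x0E : Psi x0 = (1, 0).
Hypothesis tE : forall e v w, joins e v w ->
  exists2 s : F, s != 0 & Psi (t e) = s *: edge_vec (gain Phi e v w) v w.
Hypothesis Psi_inj : forall x, lspan (x0 |` range t) x -> Psi x = 0 -> x = 0.
Variables (z : edge G -> PG hF V) (e0 : PG hF V).
Hypothesis zt : forall e, val (z e : pg_point V) = span1 (t e).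
Hypothesis e0x0 : val (e0 : pg_point V) = span1 x0.

Lemma balanced_SpanP (C : set (edge G)) :
  balanced (gain_bgraph Phi) C <-> circle C /\ ~ Span (z @` C) e0.
Proof.
split=> [[k [v [e [ve -> sum0]]]]|[[k [v [e [ve ->]]]] ne0]].
  split; first by exists k, v, e.
  by move=> /(SpanP zt _ e0x0)/(balanceP hF x0E tE Psi_inj ve).
exists k, v, e; split=> //; apply: contrapT.
by move=> /(balanceP hF x0E tE Psi_inj ve)/(SpanP zt _ e0x0).
Qed.

End Balanced.

Lemma line_throughP (F : unitRingType) (hF : GRing.field_axiom F)
    (V : lmodType F) (p q r : PG hF V) (x y t : V) :
  p <> q -> val (p : pg_point V) = span1 x -> val (q : pg_point V) = span1 y ->
  val (r : pg_point V) = span1 t ->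
  line_through p q r <-> exists a b, t = a *: x + b *: y.
Proof.
move=> pq px qy rt; split=> [[L hL [Lp Lq Lr]]|h].
  by apply/(pg_joinP px qy rt); rewrite -(pg_line_eq hF pq hL Lp Lq).
exists (pg_join p q); first by exists p, q.
split; [exact: (@pg_join_l _ _ p q)|exact: (@pg_join_r _ _ p q)|].
exact/(pg_joinP px qy rt).
Qed.

Lemma edge_underP (P : projGeom) (D : graph) (z : edge D -> P) (e0 : P)
    (Eh : set P) (hE : Eh `<=` edge_points z e0 `\ e0) (p : set_type Eh) :
  edge_line z e0 (edge_under hE p) (val p).
Proof. exact: projT2 (cid (proj1 (hE _ (set_mem (valP p))))). Qed.

Section Standard.
Variables (F : unitRingType) (hF : GRing.field_axiom F).

Section Vectors.
Variables (G : graph) (Phi : gains F G).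

Definition z_vec (e : edge G) : coord_space F (node G) :=
  edge_vec (gain Phi e (orient e).1 (orient e).2) (orient e).1 (orient e).2.

(** The scalar is 1 or -1 and absorbs the arbitrary orientation. *)
Lemma z_vecE e v w : joins e v w ->
  exists2 s : F, s != 0 & z_vec e = s *: edge_vec (gain Phi e v w) v w.
Proof.
move=> j; rewrite /z_vec; case: (joins_orient j) => -> /=.
  by exists 1; rewrite ?oner_eq0 ?scale1r.
exists (-1); rewrite ?oppr_eq0 ?oner_eq0 // (gain_opp Phi j) scaleN1r.
by rewrite /edge_vec -[RHS]/(_, _) /= opprB.
Qed.

(** A multiple of [(1, 0)] does not affect the second component, which determines the ends. *)
Lemma z_vec_ends e e' (a b : F) : z_vec e = a *: z_vec e' + b *: (1, 0) ->
  ends e = ends e'.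
Proof.
have [jw jE] := orientP e; have [jw' jE'] := orientP e'.
move=> /(congr1 snd) /=; rewrite jE jE' => E; apply: (hat_sub_ends hF jw jw' (c := a)).
by rewrite [LHS]E -[b *: 0]/(b *: (0 : node G -> F^o)) scaler0 addr0.
Qed.

(** With signs normalized, the first components add up to the gain sum and the second ones
    telescope, so the vectors sum to zero. *)
Lemma z_vec_circle k (v : 'I_k -> node G) (e : 'I_k -> edge G) i :
  circle_walk v e -> \sum_(j < k) gain Phi (e j) (v j) (v (ordS j)) = 0 ->
  lspan (z_vec @` (range e `\ e i)) (z_vec (e i)).
Proof.
move=> [k1 vI eI ve] phi0.
have /choice[s sE] j : exists s : F, s != 0 /\ z_vec (e j) =
    s *: edge_vec (gain Phi (e j) (v j) (v (ordS j))) (v j) (v (ordS j)).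
  by have [s s0 E] := z_vecE (ve j); exists s.
apply: (lspan_of_sum hF (c := fun j => (s j)^-1)) => //.
  by rewrite invr_eq0 (sE i).1.
rewrite (eq_bigr (fun j => edge_vec (gain Phi (e j) (v j) (v (ordS j))) (v j) (v (ordS j)))).
  rewrite [LHS]surjective_pairing !raddf_sum /= phi0.
  by rewrite (telescope_cycle (fun i => hat F (v i))).
by move=> j _; rewrite (sE j).2 scalerA mulVr ?scale1r ?hF ?(sE j).1.
Qed.

End Vectors.

Section Repr.
Variables (G : graph).
Let D := merge_parallel G.

(** The points [std_z] are those of the zero gains, so that facts on [z_vec] apply to them as
    well. *)
Definition zero_gains : gains F D :=
  @Gains F D (fun _ _ _ => 0) (fun _ _ _ _ => esym (oppr0 F)).

Lemma merge_simple : simple D.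
Proof. by move=> f g; exact: val_inj. Qed.

Lemma std_z_span (f : edge D) :
  val (std_z hF f : pg_point _) = span1 (z_vec zero_gains f).
Proof. by []. Qed.

Lemma std_z_inj : injective (std_z hF (G := G)).
Proof.
move=> f g fg; apply: merge_simple.
have : val (std_z hF f : pg_point _) (z_vec zero_gains f).
  by rewrite std_z_span; exact: span1_id.
rewrite fg std_z_span => -[c _ E].
by apply: (@z_vec_ends D zero_gains f g c 0); rewrite -E scale0r addr0.
Qed.

(** Forests are independent by [hat_lin_indep]; every circle has zero gain sum under [zero_gains],
    so [z_vec_circle] makes it dependent. *)
Lemma std_z_repr : graphic_repr (std_z hF (G := G)).
Proof.
split=> [|S]; first exact: std_z_inj.
apply: (iff_trans _ (iff_sym (proj_indepP std_z_span S std_z_inj))).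
split=> [|ind [C [k [v [e [ve ->]]]] CS]].
  apply: (hat_lin_indep hF (Lam := snd)) => f v w j.
  by have [s s0 E] := z_vecE zero_gains j; exists s => //; rewrite E.
have [k1 _ _ _] := ve.
have eS : S (e (Ordinal (ltnW k1))) by apply: CS; exists (Ordinal (ltnW k1)).
apply: (ind _ eS).
have := z_vec_circle (Phi := zero_gains) (i := Ordinal (ltnW k1)) ve.
rewrite big1 // => /(_ erefl); apply: lspanS.
by move=> _ [f [fe fN] <-]; exists f => //; split=> //; exact: CS.
Qed.

End Repr.

Lemma std_hyperplane_subspace (N : Type) :
  subspace [set x : coord_space F N | x.1 = 0].
Proof.
split=> // c x y /= x0 y0.
by rewrite -[LHS]/(c * x.1 + y.1) x0 y0 mulr0 addr0.
Qed.

Lemma std_e0_notin (N : Type) : ~ std_hyperplane hF N (std_e0 hF N).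
Proof.
move=> /(_ (1, 0)) /=; have : span1 ((1, 0) : coord_space F N) (1, 0).
  exact: span1_id.
by move=> h /(_ h) /eqP; rewrite oner_eq0.
Qed.

(** A larger flat contains a vector [x] with nonzero first component, and any vector minus a
    suitable multiple of [x] has first component 0. *)
Lemma std_hyperplaneP (N : Type) : hyperplane (std_hyperplane hF N).
Proof.
split=> [|HT|S fS HS].
- by apply: subspace_flat; exact: std_hyperplane_subspace.
- by apply: (@std_e0_notin N); rewrite HT.
have [SH|/existsNP[p /not_implyP[Sp Hp]]] := pselect (S `<=` std_hyperplane hF N).
  by left; apply/seteqP.
right; apply/seteqP; split=> // q _.
have sS := flat_subspace fS.
have [x x0 px] := pg_pointP (p : pg_point _); have [y y0 qy] := pg_pointP (q : pg_point _).
have x1 : x.1 != 0.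
  apply/eqP => x1; apply: Hp; rewrite /std_hyperplane /= px.
  exact: (span1_sub (@std_hyperplane_subspace N)).
apply/(vecsP S qy); rewrite -[y](subrK ((y.1 * x.1^-1) *: x)).
apply: (subspaceD sS); last first.
  by apply: (subspaceZ _ sS); apply/(vecsP S px).
set u := y - _; have u1 : u.1 = 0.
  by rewrite /u -[LHS]/(y.1 - y.1 * x.1^-1 * x.1) -mulrA mulVr ?hF // mulr1 subrr.
have [->|u0] := eqVneq u 0; first by left.
right; exists (Pt u0); last exact: span1_id.
apply: HS; rewrite /std_hyperplane /=.
exact: (span1_sub (@std_hyperplane_subspace N)).
Qed.

Section GainGraph.
Variables (G : graph) (Phi : gains F G).

Lemma z_point_span e : val (z_point hF Phi e : pg_point _) = span1 (z_vec Phi e).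
Proof. by []. Qed.

Lemma std_z_neq_e0 (f : edge (merge_parallel G)) : std_z hF f <> std_e0 hF (node G).
Proof.
move=> E; apply: (@std_e0_notin (node G)); rewrite -E /std_hyperplane /=.
exact: (span1_sub (@std_hyperplane_subspace _)).
Qed.

(** Up to a scalar, [z_vec Phi e] is the vector of [f] plus the gain times [(1, 0)]: projecting from
    the point [std_e0] forgets the gain. *)
Lemma z_point_line (f : edge (merge_parallel G)) e :
  edge_line (std_z hF (G := G)) (std_e0 hF (node G)) f (z_point hF Phi e) <->
  ends f = ends e.
Proof.
apply: (iff_trans (line_throughP (@std_z_neq_e0 f) (std_z_span f) erefl
  (z_point_span e))).
split=> [[a [b E]]|fe].
  have [jw jE] := orientP e; have [jw' jE'] := orientP f.
  rewrite jE jE'; apply/esym; have /= E2 := congr1 snd E.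
  apply: (hat_sub_ends hF jw jw' (c := a)).
  by rewrite [LHS]E2 -[b *: 0]/(b *: (0 : node G -> F^o)) scaler0 addr0.
have [jw jE] := orientP e; have jf : joins f (orient e).1 (orient e).2.
  by split=> //; rewrite fe.
have [s s0 ->] := z_vecE (zero_gains G) jf.
exists s^-1, (gain Phi e (orient e).1 (orient e).2).
rewrite scalerA mulVr ?hF // scale1r /z_vec /edge_vec -[RHS]/(_, _) /=.
by rewrite add0r -[_ *: 1]/(_ * 1) mulr1 scaler0 addr0.
Qed.

Lemma z_point_edge_points : range (z_point hF Phi)
  `<=` edge_points (std_z hF (G := G)) (std_e0 hF (node G)) `\ std_e0 hF (node G).
Proof.
move=> _ [e _ <-]; split.
  have fP : (ends e) \in range (@ends G) by apply: mem_set; exists e.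
  by exists (exist _ (ends e) fP); apply/z_point_line.
move=> /= E; have : val (std_e0 hF (node G) : pg_point _) (z_vec Phi e).
  by rewrite -E; exact: span1_id.
move=> [c _ /(congr1 snd)] /=.
rewrite -[c *: 0]/(c *: (0 : node G -> F^o)) scaler0 => /esym/eqP; apply/negP.
exact: (hat_sub_neq0 F (orientP e).1).
Qed.

(** Proportional vectors have the same ends; comparing the coordinate at one end then shows that the
    vectors, hence the gains, agree. *)
Lemma z_point_inj : no_parallel_equal_gain Phi -> injective (z_point hF Phi).
Proof.
move=> npar e e' E.
have [c E'] : exists c, z_vec Phi e = c *: z_vec Phi e'.
  have : val (z_point hF Phi e : pg_point _) (z_vec Phi e) by exact: span1_id.
  by rewrite E => -[c _ cE]; exists c.
have eE : ends e = ends e' by apply: (@z_vec_ends G Phi e e' c 0); rewrite scale0r addr0.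
have j := orientP e; have j' : joins e' (orient e).1 (orient e).2.
  by case: j => jw jE; split=> //; rewrite -eE.
apply: (npar _ _ _ _ j j').
have [s s0 sE] := z_vecE Phi j'; move: E'; rewrite sE scalerA.
rewrite -/(z_vec _ _) /z_vec /edge_vec; set v := (orient e).1; set w := (orient e).2.
move=> E'; have /(congr1 (fun h => h w)) := congr1 snd E'.
rewrite /= -[X in _ = X]/(c * s * (hat F w w - hat F v w)).
rewrite -[X in X = _]/(hat F w w - hat F v w) hatxx hat_neq; last by move/esym; case: j.
rewrite subr0 mulr1 => cs; have := congr1 fst E'.
by rewrite -cs scale1r.
Qed.

Lemma z_point_iso : no_parallel_equal_gain Phi ->
  @iso_Omega0 _ (merge_parallel G) (std_z hF (G := G)) (std_e0 hF (node G))
    (range (z_point hF Phi)) (gain_bgraph Phi) id (z_point hF Phi).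
Proof.
move=> npar; exists z_point_edge_points.
have rP e : z_point hF Phi e \in range (z_point hF Phi) by apply: mem_set; exists e.
pose b' e : set_type (range (z_point hF Phi)) := exist _ (z_point hF Phi e) (rP e).
exists b'; split=> //.
have bbij : bijective b'.
  have /choice[g gE] (p : set_type (range (z_point hF Phi))) : exists e, b' e = p.
    case: p => p pP; have [e _ ep] := set_mem pP; exists e.
    by apply: val_inj => /=.
  exists g => [e|p]; last exact: gE.
  by apply: (z_point_inj npar); have := congr1 val (gE (b' e)).
have abij : bijective (@id (node G)) by exists id.
have endsE (e : edge G) :
    @ends (Omega0_graph z_point_edge_points) (b' e) = id @` ends e.
  rewrite image_id /=; apply/z_point_line.
  exact: (edge_underP z_point_edge_points (b' e)).
split=> // C.
(* Here the vectors are already in coordinates, so [Psi] is the identity. *)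
have Psi_inj x : lspan (((1, 0) : coord_space F (node G)) |` range (z_vec Phi)) x ->
  @idfun (coord_space F (node G)) x = 0 -> x = 0 by [].
apply: (iff_trans (balanced_SpanP (Psi := idfun) erefl (@z_vecE G Phi) Psi_inj
  z_point_span (erefl : val (std_e0 hF (node G) : pg_point _) = _) C)).
rewrite /balanced /= image_comp.
by split=> -[cC h]; split=> //; move: cC;
  rewrite (circle_iso (G2 := Omega0_graph z_point_edge_points) C abij bbij endsE).
Qed.

End GainGraph.

End Standard.

(** * Coordinates for representations of graphic matroids *)

(** Equivalent elements have equal class predicates, and the choice made by [cid] depends only on
    the predicate, by proof irrelevance. *)
Lemma class_rep (T : Type) (E : T -> T -> Prop) :
  (forall x, E x x) -> (forall x y, E x y -> E y x) ->
  (forall x y z, E x y -> E y z -> E x z) ->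
  exists rho : T -> T, (forall x, E x (rho x)) /\
    forall x y, E x y -> rho x = rho y.
Proof.
move=> Er Es Et.
pose rho x := projT1 (cid (ex_intro (E x) x (Er x))); exists rho; split.
  by move=> x; exact: projT2 (cid (ex_intro (E x) x (Er x))).
move=> x y xy; rewrite /rho.
have EE : E x = E y.
  by apply/funext => z; apply/propext; split; apply: Et => //; exact: Es.
move: (ex_intro (E x) x (Er x)) (ex_intro (E y) y (Er y)); rewrite EE => p q.
by rewrite (Prop_irrelevance p q).
Qed.

Lemma skew_mulf_eq0 (F : unitRingType) (hF : GRing.field_axiom F) (a b : F) :
  a != 0 -> a * b = 0 -> b = 0.
Proof. by move=> a0 ab; rewrite -[b]mul1r -(mulVr (hF a a0)) -mulrA ab mulr0. Qed.

Lemma skew_mulfI (F : unitRingType) (hF : GRing.field_axiom F) (a b c : F) :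
  a != 0 -> a * b = a * c -> b = c.
Proof. by move=> a0; exact: (mulrI (hF a a0)). Qed.

Section GraphicCoordinates.
Variables (F : unitRingType) (hF : GRing.field_axiom F) (V : lmodType F).
Variables (D : graph) (y : edge D -> V).
Hypothesis Dsimple : simple D.
Hypothesis yP : forall S : set (edge D), graphic_indep S <-> lin_indep y S.

(** An independent [S] inside [A] already spans [y f]. Then [S] is a forest and adding [f] destroys
    this, so the circle passes through [f]. *)
Lemma fundamental_circle (A : set (edge D)) f : ~ A f -> lspan (y @` A) (y f) ->
  exists2 C, circle C & C f /\ C `<=` f |` A.
Proof.
move=> Af /lspan_indep_sub[S [SA indS Sf]].
have /contrapT[C cC CS] : ~ graphic_indep (f |` S).
  move=> /yP /(_ f) h; apply: h; first by left.
  apply: lspanS Sf => _ [e Se <-]; exists e => //; split; first by right.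
  by move=> /= ef; apply: Af; apply: SA; rewrite -ef.
exists C => //; split; last by move=> e /CS[->|/SA]; [left|right].
apply: contrapT => Cf; apply: (proj2 (yP S) indS); exists C => // e Ce.
by case: (CS e Ce) => // ef; case: Cf; rewrite -ef.
Qed.

(** A circle is dependent, but by [circle_minimal] it becomes independent once any edge is removed,
    so no coefficient can vanish. *)
Lemma circle_relation k (v : 'I_k -> node D) (e : 'I_k -> edge D) :
  circle_walk v e -> exists c : 'I_k -> F,
    (forall i, c i != 0) /\ \sum_(i < k) c i *: y (e i) = 0.
Proof.
move=> ve; have [k1 vI eI vj] := ve.
have cE : circle (range e) by exists k, v, e.
have /existsNP[f /not_implyP[[i _ <-{f}] /contrapT yi]] : ~ lin_indep y (range e).
  by move=> /yP; apply; exists (range e).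
have [c cE'] : exists c : 'I_k -> F,
    y (e i) = \sum_(j < k | j != i) c j *: y (e j).
  apply: (lspan_ordP (y := y \o e)); apply: lspanS yi => _ [_ [[j _ <-] ji] <-].
  by exists j => //=; apply/eqP => ij; apply: ji; rewrite ij.
exists (fun j => if j == i then -1 else c j); split; last first.
  rewrite (bigD1 i) //= eqxx scaleN1r cE'.
  rewrite [X in _ + X](eq_bigr (fun j => c j *: y (e j))); first by rewrite addNr.
  by move=> j /negPf ->.
move=> j; case: ifPn => [_|ji]; first by rewrite oppr_eq0 oner_eq0.
apply/eqP => cj0.
have ej : range e (e j) by exists j.
have /yP/(_ (e i)) := circle_minimal cE ej; apply.
  by split; [exists i|move=> /eI ij; rewrite ij eqxx in ji].
rewrite cE'; apply: (subspace_sum _ (lspan_subspace _)) => m mi.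
have [->|mj] := eqVneq m j.
  rewrite cj0 scale0r; exact: (lspan_subspace _).1.
apply: (subspaceZ _ (lspan_subspace _)); apply: sub_lspan; exists (e m) => //.
split; last by move=> /eI /eqP; rewrite (negPf mi).
by split; [exists m|move=> /eI /eqP; rewrite (negPf mj)].
Qed.

(* The edges at v are grouped by the component of D - v they lead to. Modulo
   the edges of D - v, representatives of the groups are independent and the
   members of a group are proportional. *)
Lemma node_functional (v : node D) : exists l : {linear V -> F^o},
  forall f, (l (y f) != 0) <-> ends f v.
Proof.
pose Sv := [set f : edge D | ~ ends f v].
have Sv_sym := @conn_sym _ (estep Sv) _ _ (@estep_sym D Sv).
(* Edges at [v] are equivalent when they lead to the same component of D - v; any other edge is
   equivalent only to itself. *)
pose E f g := f = g \/
  exists u u', [/\ joins f v u, joins g v u' & conn (estep Sv) u u'].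
have [||f g k|rho [Erho rhoE]] := @class_rep _ E.
- by left.
- move=> f g [->|[u [u' [ju ju' c]]]]; first by left.
  by right; exists u', u; split=> //; exact: Sv_sym.
- move=> [->//|[u [u' [ju ju' c]]]] [<-|[w [w' [jw jw' c']]]].
    by right; exists u, u'.
  right; exists u, w'; split=> //; rewrite (joins_other ju' jw) in c'.
  exact: conn_trans c c'.
have Eends f g : E f g -> ends f v -> ends g v.
  by move=> [<-//|[u [u' [_ /joins_ends[]]]]].
pose A := [set f : edge D | ends f v -> rho f = f].
have rhoA f : A (rho f) by move=> _; rewrite -(rhoE _ _ (Erho f)).
have Xv u x : u <> v -> conn (estep Sv) u x -> x <> v.
  move=> uv /(_ [set x | x <> v]); apply=> // a b _ [g Sg /joins_ends[ga gb]] bv.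
  by apply: Sg; rewrite -bv.
(* Prescribe 1 on the representatives at [v] and 0 on all edges missing [v], which may be
   dependent. *)
have [f Af Yf yf|l lE] := linear_ext_family hF (y := y) (A := A)
  (Y := fun f => (`[< ends f v >])%:R : F^o).
  have fv : ends f v by apply: contrapT => fv; apply: Yf; rewrite asboolF.
  have [u jf] : exists u, joins f v u.
    have [a [b [ab fE]]] := ends_link f; move: fv; rewrite fE => -[->|->].
      by exists b.
    by exists a; apply: joinsC.
  have [|C cC [Cf CA]] := fundamental_circle _ yf; first by case=> _; apply.
  have uv : u <> v by case: jf => + _ => /[swap] ->; apply.
  (* The circle must leave the component of [u] in D - v by a second edge at [v]; being the
     representative of the same group, that edge is [f]. *)
  apply: (@circle_cut _ C (conn (estep Sv) u) f u v cC Cf (joinsC jf)).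
  - exact: conn_refl.
  - by move=> /(Xv _ _ uv); apply.
  move=> g x x' Cg gf jg ux; have [gf'|[Ag _]] := CA g Cg; first by case: gf.
  have [gv|gv] := pselect (ends g v); last by apply: conn_step ux _; exists g.
  have xv := Xv _ _ uv ux.
  have x'v : v = x' by move: gv; case: jg => _ -> [vx|//]; case: xv.
  case: gf; rewrite -(Ag gv) -[RHS](Af fv); apply/esym/rhoE; right.
  by exists u, x; split=> //; rewrite x'v; exact: joinsC.
exists l => f; split.
  move=> lf; apply: contrapT => fv; move: lf.
  by rewrite lE ?asboolF ?eqxx // /A /= => /fv.
move=> fv; set g := rho f.
have lg : l (y g) = 1.
  by rewrite lE; [rewrite asboolT //; apply: Eends (Erho f) fv|exact: rhoA].
have [->|[u [u' [ju ju' uu']]]] := Erho f; first by rewrite lg oner_eq0.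
have [->|fg] := pselect (f = g); first by rewrite lg oner_eq0.
(* A circle through [f] with its other edges in [S] must return to [v] by [g], so only [f] and [g]
   can contribute when [l] is applied to its relation. *)
pose S := Sv `|` [set g].
have Sf : ~ S f by case=> // /(_ fv).
have vSu : conn (estep S) v u.
  apply: (@conn_trans _ _ _ u').
    by apply: conn_step; [exact: conn_refl|exists g => //; right].
  apply: (Sv_sym _ _ uu' (conn (estep S) u')); first exact: conn_refl.
  by move=> a b ua [e Se je]; apply: conn_step ua _; exists e => //; left.
have [C cC [Cf CS]] := circle_of_conn ju Sf vSu.
have Cg : C g.
  apply: contrapT => nCg.
  apply: (@circle_cut _ C [set v] f v u cC Cf ju) => //.
    by case: ju => + _ => /[swap] ->; apply.
  move=> e x x' Ce ef je /= xv; have [//|[Se|eg]] := CS e Ce.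
    by case: Se; rewrite -xv; case: (joins_ends je).
  by case: nCg; rewrite -eg.
have [k [w [e [we CE]]]] := cC; have [c [c0 csum]] := circle_relation we.
have [k1 wI eI wj] := we.
move: Cf Cg CS; rewrite CE => -[i _ ei] [j _ ej] CS.
apply/eqP => lf0; have := congr1 l csum; rewrite linear0 linear_sum /=.
rewrite (bigD1 j) //= big1 => [|m mj].
  rewrite linearZ /= ej lg addr0 -[_ *: _]/(c j * 1) mulr1 => /eqP.
  by rewrite (negPf (c0 j)).
rewrite linearZ /=; have [|fE|[Sm|mg]] := CS (e m); first by exists m.
- by rewrite fE lf0 scaler0.
- rewrite lE ?asboolF ?scaler0 // /A /= => /Sm //.
- by move: mj; rewrite -ej in mg; rewrite (eI _ _ mg) eqxx.
Qed.

(** * Rescaling the node functionals by a potential *)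

Section Potential.
Variable L : node D -> {linear V -> F^o}.
Hypothesis LE : forall v f, L v (y f) != 0 <-> ends f v.

(** A graph covering [D] with fibre [F]. The wanted rescaling is a section of it, which exists once
    closed walks have closed lifts. *)
Definition lift_step (p q : node D * F) : Prop := exists2 f,
  joins f p.1 q.1 & L p.1 (y f) * p.2 + L q.1 (y f) * q.2 = 0.

(* A shortest closed walk whose lift is not closed would be a circle; but the
   unique linear relation along a circle makes its lift closed. *)
Lemma lift_closed n p : walk lift_step n p -> (p 0%N).1 = (p n).1 ->
  (p 0%N).2 = (p n).2.
Proof.
elim/ltn_ind: n p => n IH p wp p0n.
(* A proper closed subwalk has a closed lift by induction; cutting it out leaves a shorter closed
   walk. *)
have [[i [j [ij jn ijn pij]]]|inj] := pselect (exists i j,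
    [/\ (i < j)%N, (j <= n)%N, (j - i < n)%N & (p i).1 = (p j).1]).
  have pijE : p i = p j.
    rewrite (surjective_pairing (p i)) (surjective_pairing (p j)) pij; congr (_, _).
    have := IH (j - i)%N ijn (fun m => p (i + m)%N).
    rewrite addn0 subnKC; last by lia.
    by apply=> // m mij; rewrite addnS; apply: wp; lia.
  have [|q [wq q0 qn]] := walk_cut wp _ pijE; first by lia.
  by rewrite -q0 -qn; apply: IH wq _; [lia|rewrite q0 qn].
have [n0|n0] := posnP n; first by rewrite n0.
have [f0 _ _] := wp 0%N n0.
have /choice[e eP] m : exists f, (m < n)%N -> joins f (p m).1 (p m.+1).1 /\
    L (p m).1 (y f) * (p m).2 + L (p m.+1).1 (y f) * (p m.+1).2 = 0.
  have [mn|nm] := ltnP m n; last by exists f0.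
  by have [f jf fE] := wp m mn; exists f.
have Lne m : (m < n)%N -> L (p m).1 (y (e m)) != 0.
  by move=> mn; apply/LE; case: (eP m mn) => /joins_ends[].
have n2 : (1 < n)%N.
  have n1 : n <> 1%N; last lia.
  move=> n1; have [[]] := eP 0%N n0; rewrite p0n n1 => nn; by case: nn.
(* As [D] is simple, a closed walk of length 2 runs along one edge and back. *)
have [n2'|n3] := leqP n 2.
  have nE : n = 2%N by lia.
  rewrite nE in p0n wp eP Lne *.
  have [j0 s0] := eP 0%N isT; have [j1 s1] := eP 1%N isT.
  have ee : e 1%N = e 0%N.
    apply: Dsimple; case: j0 j1 => _ -> [_ ->]; by rewrite p0n setUC.
  apply: (skew_mulfI hF (Lne 0%N isT)).
  move: s0 s1; rewrite ee -p0n => s0; rewrite -s0 addrC => /addIr //.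
have pI (i j : 'I_n) : (p i).1 = (p j).1 -> i = j.
  have hi := ltn_ord i; have hj := ltn_ord j.
  move=> pij; apply: val_inj => /=; apply: contrapT => ij; apply: inj.
  have [l|l|//] := ltngtP i j; [exists i, j|exists j, i]; split=> //; lia.
have ve (i : 'I_n) : joins (e i) (p i).1 (p (ordS i)).1.
  have [ji _] := eP i (ltn_ord i); have [iE|iN] := eqVneq i.+1 n.
    by move: ji; rewrite /= iE modnn p0n.
  by rewrite /= modn_small //; have := ltn_ord i; lia.
have cw : circle_walk (fun i : 'I_n => (p i).1) (fun i : 'I_n => e i).
  (* An edge used at two positions would be traversed both ways, which is impossible for length
     above 2. *)
  split=> // i j eij; have hi := ltn_ord i; have hj := ltn_ord j.
  have := ve j; rewrite -eij => /(joins_inv (ve i))[[/pI //]|[/pI ji /pI ij]].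
  exfalso; move: ij; rewrite ji => /(congr1 val) /=.
  have [iE|iN] := eqVneq i.+1 n; first by rewrite iE modnn modn_small; lia.
  rewrite (modn_small (_ : (i.+1 < n)%N)); last by lia.
  have [iE|iN'] := eqVneq i.+2 n; first by rewrite iE modnn; lia.
  by rewrite modn_small; lia.
have [c [c0 csum]] := circle_relation cw.
(* The functional of a node on the circle keeps only the two terms of the circle edges at that
   node. *)
have rel (i : 'I_n) : c i * L (p (ordS i)).1 (y (e i)) +
    c (ordS i) * L (p (ordS i)).1 (y (e (ordS i))) = 0.
  have := congr1 (L (p (ordS i)).1) csum; rewrite linear0 linear_sum /=.
  have Si : ordS i != i.
    by apply/eqP => E; have [+ _] := ve i; rewrite E; apply.
  rewrite (bigD1 i) //= (bigD1 (ordS i)) //= big1 => [|j /andP[ji jS]].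
    by rewrite addr0 !linearZ.
  rewrite linearZ /=; suff -> : L (p (ordS i)).1 (y (e j)) = 0 by rewrite scaler0.
  apply/eqP; apply: contraTT isT => /LE; have [_ ->] := ve j.
  case=> [/pI E|/pI /ordS_inj E]; first by rewrite E eqxx in jS.
  by rewrite E eqxx in ji.
(* This quantity is constant along the walk, by [rel] and the step equations; 0 is a default outside
   the index range. *)
pose T m := if insub m is Some i then c i * L (p m).1 (y (e m)) * (p m).2 else 0.
have TE (i : 'I_n) : T i = c i * L (p i).1 (y (e i)) * (p i).2.
  by rewrite /T valK.
have stepT (i : 'I_n) :
    T i = c (ordS i) * L (p (ordS i)).1 (y (e (ordS i))) * (p i.+1).2.
  have [_ si] := eP i (ltn_ord i).
  have pS : (p i.+1).1 = (p (ordS i)).1.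
    have [iE|iN] := eqVneq i.+1 n; first by rewrite /= iE modnn p0n.
    by rewrite /= modn_small //; have := ltn_ord i; lia.
  have /eqP := rel i; rewrite addrC addr_eq0 => /eqP ->.
  move/eqP: si; rewrite addr_eq0 => /eqP si.
  by rewrite TE -mulrA si pS mulrN mulNr mulrA.
have T0 m : (m < n)%N -> T m = T 0%N.
  elim: m => // m IHm mn; rewrite -IHm; last by lia.
  have mn' : (m < n)%N by lia.
  have iE : ordS (Ordinal mn') = m.+1 :> nat by rewrite /= modn_small.
  by rewrite -iE TE -[T m]/(T (Ordinal mn')) stepT iE.
have nn : (n.-1 < n)%N by lia.
have iE : ordS (Ordinal nn) = 0%N :> nat by rewrite /= prednK // modnn.
(* The last step returns to the edge of index 0 with the final value in place of the initial one;
   cancel the nonzero factor. *)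
have := stepT (Ordinal nn); rewrite -[T (Ordinal nn)]/(T n.-1) T0 // -{1}iE TE.
rewrite -[(Ordinal nn).+1]/(n.-1.+1) prednK // iE => /mulrI E; apply: E.
apply: hF; apply/eqP => /(skew_mulf_eq0 hF (c0 _))/eqP.
by rewrite (negPf (Lne 0%N n0)).
Qed.

Lemma lift_step_sym p q : lift_step p q -> lift_step q p.
Proof. by move=> [f jf fE]; exists f; [exact: joinsC|rewrite addrC]. Qed.

Lemma lift_conn_uniq v a b : conn lift_step (v, a) (v, b) -> a = b.
Proof.
move=> c; have [n [p [wp p0 pn _]]] := conn_simple_walk c.
by have := lift_closed wp; rewrite p0 pn => /(_ erefl).
Qed.

Lemma lift_exists f v w a : joins f v w -> a != 0 ->
  exists2 b, b != 0 & lift_step (v, a) (w, b).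
Proof.
move=> jf a0; have [fv fw] := joins_ends jf.
have [/LE Lv /LE Lw] := (fv, fw).
exists (- ((L w (y f))^-1 * (L v (y f) * a))).
  rewrite oppr_eq0; apply/eqP => /(skew_mulf_eq0 hF).
  rewrite invr_eq0 => /(_ Lw) /(skew_mulf_eq0 hF Lv)/eqP.
  by rewrite (negPf a0).
by exists f => //=; rewrite mulrN mulrA mulrV ?hF // mul1r subrr.
Qed.

(** Start with 1 at a representative of each component and transport along walks; [lift_conn_uniq]
    makes the value unique. *)
Lemma potential_exists : exists h : node D -> F, (forall v, h v != 0) /\
  forall f v w, joins f v w -> L v (y f) * h v + L w (y f) * h w = 0.
Proof.
have [|||rho [rhoP rhoE]] := @class_rep _ (conn (@estep D setT)).
- by move=> v; exact: conn_refl.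
- by move=> v w; apply: conn_sym; exact: estep_sym.
- by move=> u v w; exact: conn_trans.
have /choice[h hP] v : exists a, a != 0 /\ conn lift_step (rho v, 1) (v, a).
  pose X u := exists a, a != 0 /\ conn lift_step (rho v, 1) (u, a).
  apply: (@conn_sym _ _ _ _ (@estep_sym D setT) (rhoP v) X).
    by exists 1; rewrite oner_eq0; split=> //; exact: conn_refl.
  move=> u w [a [a0 ca]] [f _ jf]; have [b b0 sb] := lift_exists jf a0.
  by exists b; split=> //; exact: conn_step ca sb.
exists h; split=> [v|f v w jf]; first exact: (hP v).1.
have [b b0 sb] := lift_exists jf (hP v).1.
have rvw : rho v = rho w.
  by apply: rhoE; apply: conn_step; [exact: conn_refl|exists f].
have -> : h w = b.
  apply: (@lift_conn_uniq w); apply: conn_trans (conn_step (hP v).2 sb).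
  by rewrite rvw; apply: conn_sym (hP w).2; exact: lift_step_sym.
have [g jg] := sb; suff -> : g = f by [].
by apply: Dsimple; case: jf jg => _ -> [_ ->].
Qed.

End Potential.

Lemma graphic_coordinates : exists Lam : {linear V -> (node D -> F^o)},
  (forall f v w, joins f v w ->
     exists2 s : F, s != 0 & Lam (y f) = s *: (hat F w - hat F v)) /\
  forall x, lspan (range y) x -> Lam x = 0 -> x = 0.
Proof.
have /choice[L LE] := node_functional.
have [h [h0 hE]] := potential_exists LE.
(* Scaling on the right by [h v] preserves linearity for the left action. *)
pose lam (x : V) : node D -> F^o := fun v => L v x * h v.
have lam_lin : linear lam.
  move=> c x x'; apply/funext => v; rewrite /lam linearP mulrDl -[c *: _]/(c * _).
  by rewrite -mulrA.
pose Lam : {linear V -> (node D -> F^o)} :=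
  HB.pack lam (GRing.isLinear.Build F V (node D -> F^o) _ lam lam_lin).
have LamE f v w : joins f v w ->
    exists2 s : F, s != 0 & Lam (y f) = s *: (hat F w - hat F v).
  move=> jf; exists (L w (y f) * h w).
    have [_ /LE Lw] := joins_ends jf.
    by apply/eqP => /(skew_mulf_eq0 hF Lw)/eqP; rewrite (negPf (h0 w)).
  apply/funext => u; rewrite -[RHS]/(L w (y f) * h w * (hat F w u - hat F v u)).
  rewrite -[LHS]/(L u (y f) * h u).
  have [->|uw] := pselect (u = w).
    by rewrite hatxx hat_neq ?subr0 ?mulr1 // => /esym; case: jf.
  have [->|uv] := pselect (u = v).
    rewrite hatxx hat_neq; last by case: jf.
    by rewrite sub0r mulrN1; apply/eqP; rewrite -addr_eq0 hE.
  rewrite !hat_neq // subrr mulr0; suff -> : L u (y f) = 0 by rewrite mul0r.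
  by apply/eqP; apply: contraTT isT => /LE; case: jf => _ -> [].
clearbody Lam; exists Lam; split=> // x /lspan_indep_sub[S [_ indS Sx]] x0.
(* [Lam] keeps the forest [S] independent, so some linear [g] sends the images back to the [y f] and
   inverts [Lam] on their span. *)
have indLam : lin_indep (Lam \o y) S.
  by apply: (hat_lin_indep hF (Lam := idfun)) => //; apply/yP.
have [f Sf _|g gE] := linear_ext_family hF (y := Lam \o y) (Y := y) (A := S).
  exact: indLam.
have : g (Lam x) = x.
  apply: (lspan_le (W := [set x | g (Lam x) = x])) Sx.
    split=> [|c a b /= ga gb]; first by rewrite /= !linear0.
    by rewrite !linearP ga gb.
  by move=> _ [f Sf <-]; exact: gE.
by rewrite x0 linear0.
Qed.

End GraphicCoordinates.

(** * Gain graphs from orthographic representations *)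

Lemma proj_map_span (F : unitRingType) (V W : lmodType F) (f : {linear V -> W})
    (hf : injective f) (p : pg_point V) (x : V) :
  val p = span1 x -> val (proj_map hf p) = span1 (f x).
Proof.
move=> px; rewrite /= px; apply/seteqP; split=> [_ [_ [a _ <-] <-]|_ [a _ <-]].
  by exists a => //; rewrite linearZ.
by exists (a *: x); [exists a|rewrite linearZ].
Qed.

Section Converse.
Variables (F : unitRingType) (hF : GRing.field_axiom F) (V : lmodType F).
Variables (H : set (PG hF V)) (D : graph) (z' : edge D -> PG hF V).
Variables (e0 : PG hF V) (Eh : set (PG hF V)).

(** The relation [L] pairs [x] with [a] when [x - a *: x0] lies in [H]; it is single-valued because
    [x0] is outside [H]. *)
Lemma hyperplane_functional (x0 : V) : flat H -> ~ H e0 ->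
  val (e0 : pg_point V) = span1 x0 -> exists l : {linear V -> F^o},
    l x0 = 1 /\ forall x, vecs H x -> l x = 0.
Proof.
move=> fH He0 e0x; have sH := flat_subspace fH.
pose L := [set q : (V * F^o)%type | vecs H (q.1 - (q.2 : F) *: x0)].
have sL : subspace L.
  split; first by rewrite /L /= scale0r subr0; left.
  move=> c [x a] [y b]; rewrite /L /= => xa yb.
  rewrite -[c *: a]/(c * a) scalerDl opprD addrACA -scalerA -scalerBr.
  exact: sH.2.
have [u|l lE] := linear_extension hF sL.
  rewrite /L /= sub0r => ux; apply/eqP; apply: contrapT => /negP u0; apply: He0.
  apply/(vecsP H e0x); have := subspaceZ (- u^-1) sH ux.
  by rewrite scalerN scaleNr opprK scalerA mulVr ?hF // scale1r.
exists l; split=> [|x Hx]; apply: lE; rewrite /L /=.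
  by rewrite scale1r subrr; left.
by rewrite scale0r subr0.
Qed.

Lemma orthographic_coordinates (G : graph) (a : node G -> node D)
    (x0 : V) (y : edge D -> V) :
  orthographic_frame H z' e0 -> bijective a ->
  val (e0 : pg_point V) = span1 x0 ->
  (forall f, val (z' f : pg_point V) = span1 (y f)) ->
  exists Psi : {linear V -> coord_space F (node G)},
  [/\ Psi x0 = (1, 0),
      forall f v w, joins f (a v) (a w) -> exists2 s : F, s != 0 &
        Psi (y f) = (0, s *: (hat F w - hat F v))
    & forall x, lspan (x0 |` range y) x -> Psi x = 0 -> x = 0].
Proof.
move=> [[fH _ _] _ Ds zH [zI zP] He0] [a' aK a'K] e0x zy.
have [l [lx0 lH]] := hyperplane_functional fH He0 e0x.
have ly f : l (y f) = 0 by apply: lH; apply/(vecsP H (zy f)); exact: zH.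
have yP S : graphic_indep S <-> lin_indep y S.
  exact: iff_trans (zP S) (proj_indepP zy S zI).
have [Lam [LamE Lam_inj]] := graphic_coordinates hF Ds yP.
(* The second component applies [Lam] after projecting along [x0] onto the kernel of [l], with nodes
   renamed through [a]. *)
pose psi (x : V) : coord_space F (node G) :=
  (l x, fun v => Lam (x - (l x : F) *: x0) (a v)).
have psi_lin : linear psi.
  move=> c x x'; rewrite /psi -[RHS]/(_, _); congr pair; first by rewrite linearP.
  apply/funext => v; rewrite linearP scalerDl opprD addrACA -[c *: l x]/(c * l x).
  by rewrite -scalerA -scalerBr linearP.
pose Psi : {linear V -> coord_space F (node G)} :=
  HB.pack psi (GRing.isLinear.Build F V (coord_space F (node G)) _ psi psi_lin).
exists Psi; split.
- rewrite -[LHS]/(psi x0) /psi lx0; congr pair; apply/funext => v.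
  by rewrite scale1r subrr linear0.
- move=> f v w jf; have [s s0 sE] := LamE _ _ _ jf; exists s => //.
  rewrite -[LHS]/(psi (y f)) /psi ly scale0r subr0 sE; congr pair.
  apply/funext => u; rewrite -[LHS]/(s * (hat F (a w) (a u) - hat F (a v) (a u))).
  rewrite -[RHS]/(s * (hat F w u - hat F v u)) !hatE.
  congr (_ * ((nat_of_bool _)%:R - (nat_of_bool _)%:R)); apply/asbool_equiv_eq.
    by split=> [/(can_inj aK)|->].
  by split=> [/(can_inj aK)|->].
- move=> x xS [lx Lx].
  have : lspan (range y) (x - (l x : F) *: x0).
    apply: (lspan_le (W := [set x | lspan (range y) (x - (l x : F) *: x0)])) xS.
      have sY := lspan_subspace (range y).
      split=> [|c u u' /= Yu Yu']; first by rewrite /= linear0 scale0r subr0; exact: sY.1.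
      rewrite linearP scalerDl opprD addrACA -[c *: l u]/(c * l u).
      by rewrite -scalerA -scalerBr; exact: sY.2.
    move=> _ [->|[f _ <-]] /=.
      by rewrite lx0 scale1r subrr; exact: (lspan_subspace _).1.
    by rewrite ly scale0r subr0; apply: sub_lspan; exists f.
  rewrite lx scale0r subr0 => /Lam_inj; apply; apply/funext => v.
  have := congr1 (fun h => h (a' v)) Lx; rewrite /= a'K lx scale0r subr0 => ->.
  by [].
Qed.

(** Let [g] be a linear map inverting [Psi] on the image of [S]. The extra component [x - g (Psi x)]
    vanishes on [S] and makes the map injective. *)
Lemma embedding_of_coordinates (C : lmodType F) (Psi : {linear V -> C}) (S : set V) :
  subspace S -> (forall x, S x -> Psi x = 0 -> x = 0) ->
  exists2 i : {linear V -> (C * V)%type}, injective i &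
    forall x, S x -> i x = (Psi x, 0).
Proof.
move=> sS Psi_inj.
pose L := [set q : (C * V)%type | S q.2 /\ q.1 = Psi q.2].
have [||g gE] := linear_extension hF (L := L).
- split; first by split; [exact: sS.1|rewrite /= linear0].
  move=> c [u x] [u' x'] [/= Sx ->] [/= Sx' ->]; split; first exact: sS.2.
  by rewrite /= linearP.
- by move=> x [/= Sx /esym]; exact: Psi_inj.
pose i (x : V) : (C * V)%type := (Psi x, x - g (Psi x)).
have i_lin : linear i.
  move=> c x x'; rewrite /i -[RHS]/(_, _); congr pair; first by rewrite linearP.
  by rewrite /= !linearP addrACA -scalerDr.
pose I : {linear V -> (C * V)%type} :=
  HB.pack i (GRing.isLinear.Build F V (C * V)%type _ i i_lin).
exists I => [x x' [PE]|x Sx].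
  by rewrite PE => /addIr.
by rewrite -[LHS]/(i x) /i (gE (Psi x) x) ?subrr.
Qed.

Lemma gain_graph_of_orthographic (O : bgraph) (a : node (underlying O) -> node D)
    (eh : edge (underlying O) -> PG hF V) :
  is_biased O -> synthetic_orthographic H z' e0 Eh a eh ->
  exists Phi : gains F (underlying O),
    gain_bgraph Phi = O /\
    exists (W : lmodType F) (i : {linear V -> W}) (hi : injective i)
           (U : lmodType F)
           (c : {linear W -> (coord_space F (node (underlying O)) * U)%type})
           (hc : bijective c),
      proj_map (bij_inj hc) (proj_map hi e0)
        = pad_point U (std_e0 hF (node (underlying O))) /\
      forall e : edge (underlying O),
        proj_map (bij_inj hc) (proj_map hi (eh e))
          = pad_point U (z_point hF Phi e).
Proof.
case: O a eh => G B /= a eh _ [frame [hE [b' [bE [abij bbij endsE balE]]]]].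
have [x0 e0x] : exists u : V, val (e0 : pg_point V) = span1 u.
  by have [u _ E] := pg_pointP (e0 : pg_point V); exists u.
have /choice[y zy] f : exists u : V, val (z' f : pg_point V) = span1 u.
  by have [u _ E] := pg_pointP (z' f : pg_point V); exists u.
have /choice[t et] e : exists u : V, val (eh e : pg_point V) = span1 u.
  by have [u _ E] := pg_pointP (eh e : pg_point V); exists u.
have [Psi [Psix0 Psiy Psi_inj]] :=
  orthographic_coordinates frame abij e0x zy.
have ze0 f : z' f <> e0.
  by move=> E; case: frame => _ _ _ zH _; apply; rewrite -E; exact: zH.
have tE e : exists f c d, [/\ t e = c *: y f + d *: x0, c != 0 &
    forall v w, joins e v w -> joins f (a v) (a w)].
  have := edge_underP hE (b' e); set f := edge_under hE (b' e).
  rewrite bE => /(line_throughP (ze0 f) (zy f) e0x (et e))[c [d tE]].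
  exists f, c, d; split=> //.
    (* With [c] zero the point of [e] would be [e0], which is not in [Eh]. *)
    apply/eqP => c0; have [_] := hE _ (set_mem (valP (b' e))); apply.
    rewrite bE /=; apply/esym/(Pt_eq hF e0x (et e) (span1_neq0 (et e)) (a := d)).
    by rewrite tE c0 scale0r add0r.
  move=> v w [vw eE]; split; first by move=> /(bij_inj abij).
  by have := endsE e; rewrite /= -/f => ->; rewrite eE image_setU !image_set1.
have tPsi e v w : joins e v w -> exists s d : F, s != 0 /\
    Psi (t e) = (d, s *: (hat F w - hat F v)).
  move=> je; have [f [c [d [-> c0 fj]]]] := tE e.
  have [s s0 sE] := Psiy _ _ _ (fj _ _ je).
  exists (c * s), d; split.
    by apply/eqP => /(skew_mulf_eq0 hF c0)/eqP; rewrite (negPf s0).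
  rewrite linearD !linearZ /= sE Psix0 -[LHS]/(_, _); congr pair.
    by rewrite /= -[c *: 0]/(c * 0) -[d *: 1]/(d * 1) mulr0 add0r mulr1.
  by rewrite /= -[d *: 0]/(d *: (0 : node G -> F^o)) scaler0 addr0 scalerA.
(* In [Psi (t e) = (d, s *: (hat F w - hat F v))] the coordinate at [w] is [s]; dividing by it gives
   the gain, and swapping the ends changes its sign. *)
pose gn (e : edge G) (v w : node G) : F := ((Psi (t e)).2 w)^-1 * (Psi (t e)).1.
have gnE e v w s d : v <> w -> Psi (t e) = (d, s *: (hat F w - hat F v)) ->
    gn e v w = s^-1 * d.
  move=> vw E; rewrite /gn E /=; congr (_^-1 * _).
  rewrite -[LHS]/(s * (hat F w w - hat F v w)) hatxx hat_neq ?subr0 ?mulr1 //.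
  by move/esym.
have gn_opp e v w : joins e v w -> gn e w v = - gn e v w.
  move=> je; have [s [d [s0 E]]] := tPsi e v w je; have [vw _] := je.
  rewrite (gnE _ _ _ _ _ vw E) (gnE e w v (- s) d) ?invrN ?mulNr //.
    by move/esym.
  by rewrite E scaleNr -scalerN opprB.
pose Phi : gains F G := Gains gn_opp.
have PsiE e v w : joins e v w ->
    exists2 s : F, s != 0 & Psi (t e) = s *: edge_vec (gain Phi e v w) v w.
  move=> je; have [s [d [s0 E]]] := tPsi e v w je; have [vw _] := je.
  exists s => //; rewrite /= (gnE _ _ _ _ _ vw E) E -[RHS]/(_, _) /=.
  by rewrite -[s *: (_ * _)]/(s * (s^-1 * d)) mulrA mulrV ?hF // mul1r.
have tS : lspan (x0 |` range t) `<=` lspan (x0 |` range y).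
  have sY := lspan_subspace (x0 |` range y).
  apply: lspan_le => // _ [->|[e _ <-]]; first by apply: sub_lspan; left.
  have [f [c [d [-> _ _]]]] := tE e; apply: sY.2.
    by apply: sub_lspan; right; exists f.
  by apply: (subspaceZ _ sY); apply: sub_lspan; left.
have tinj x : lspan (x0 |` range t) x -> Psi x = 0 -> x = 0.
  by move=> /tS; exact: Psi_inj.
exists Phi; split.
  congr (@BGraph G _); apply/seteqP.
  have valb C : [set val (p : set_type Eh) | p in b' @` C] = eh @` C.
    by rewrite image_comp; congr (_ @` _); apply/funext => e /=; exact: bE.
  have BP C : B C <-> circle C /\ ~ @Span (PG hF V) (eh @` C) e0.
    apply: (iff_trans (balE C)); rewrite /balanced /= valb.
    by split=> -[cC h]; split=> //; move: cC;
      rewrite -(circle_iso (G2 := Omega0_graph hE) C abij bbij endsE).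
  have PP C := balanced_SpanP Psix0 PsiE tinj et e0x C.
  by split=> C h; [apply/BP/PP|apply/PP/BP].
have [i i_inj iE] := embedding_of_coordinates (lspan_subspace (x0 |` range t)) tinj.
(* The enlarged space is already a product with the coordinate space, so the change of coordinates
   is the identity. *)
exists (coord_space F (node G) * V)%type, i, i_inj, V, idfun.
have hc : bijective (@idfun (coord_space F (node G) * V)%type) by exists idfun.
exists hc; split=> [|e].
  apply: val_inj; rewrite (proj_map_span _ (proj_map_span i_inj e0x)).
  rewrite (proj_map_span _ (erefl : val (std_e0 hF (node G) : pg_point _) = _)) /=.
  by rewrite iE ?Psix0 //; apply: sub_lspan; left.
have [s s0 sE] := PsiE e _ _ (orientP e).
have iC := proj_map_span (bij_inj hc) (proj_map_span i_inj (et e)).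
apply/esym; apply: (Pt_eq hF (proj_map_span _ (z_point_span hF Phi e)) iC
  (span1_neq0 iC) (a := s)).
rewrite /= iE; last by apply: sub_lspan; right; exists e.
by rewrite sE /pad -[RHS]/(_, _) /= scaler0.
Qed.

End Converse.

Theorem theorem3p6 (F : unitRingType) (hF : GRing.field_axiom F) :
  (* (a) *)
  (forall (G : graph) (Phi : gains F G),
     no_parallel_equal_gain Phi ->
     [/\ graphic_repr (std_z hF (G := G)),
         forall f : edge (merge_parallel G), std_hyperplane hF (node G) (std_z hF f),
         range (z_point hF Phi)
           `<=` edge_points (std_z hF (G := G)) (std_e0 hF (node G))
                `\ std_e0 hF (node G),
         @iso_Omega0 _ (merge_parallel G) (std_z hF (G := G)) (std_e0 hF (node G))
           (range (z_point hF Phi)) (gain_bgraph Phi) id (z_point hF Phi)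
       & inhabited (node G) ->
         @synthetic_orthographic _ (std_hyperplane hF (node G))
           (merge_parallel G) (std_z hF (G := G)) (std_e0 hF (node G))
           (range (z_point hF Phi)) (gain_bgraph Phi) id (z_point hF Phi)])
  /\
  (* (b) *)
  (forall (V : lmodType F) (H : set (PG hF V)) (D : graph)
          (z' : edge D -> PG hF V) (e0 : PG hF V) (Eh : set (PG hF V))
          (O : bgraph)
          (a : node (underlying O) -> node D)
          (eh : edge (underlying O) -> PG hF V),
     is_biased O ->
     synthetic_orthographic H z' e0 Eh a eh ->
     exists Phi : gains F (underlying O),
       gain_bgraph Phi = O /\
       exists (W : lmodType F) (i : {linear V -> W}) (hi : injective i)
              (U : lmodType F)
              (c : {linear W -> (coord_space F (node (underlying O)) * U)%type})
              (hc : bijective c),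
         proj_map (bij_inj hc) (proj_map hi e0)
           = pad_point U (std_e0 hF (node (underlying O))) /\
         forall e : edge (underlying O),
           proj_map (bij_inj hc) (proj_map hi (eh e))
             = pad_point U (z_point hF Phi e)).
Proof.
split=> [G Phi npar|V H D z' e0 Eh O a eh]; last exact: gain_graph_of_orthographic.
have inH (f : edge (merge_parallel G)) : std_hyperplane hF (node G) (std_z hF f).
  exact: (span1_sub (@std_hyperplane_subspace _ _)).
split=> //; [exact: std_z_repr|exact: z_point_edge_points|exact: z_point_iso|].
move=> inh; split; last exact: z_point_iso.
split=> //; [exact: std_hyperplaneP|exact: merge_simple|exact: std_z_repr|].
exact: std_e0_notin.
Qed.
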